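(* Let $k$ be a commutative ring and let $\mathsf C$ be a $k$-linear Hom-finite abelian length category. The set $\mathsf{Sp}\,\mathsf C$ of irreducible characters is partially ordered by $$\chi\subseteq\psi\quad\Longleftrightarrow\quad\mathsf{sub}\,\chi\subseteq\mathsf{sub}\,\psi.$$ In particular, each $\chi\in\mathsf{Sp}\,\mathsf C$ is uniquely determined by the set of finite characters in $\mathsf{sub}\,\chi$.
   Context: An abelian length category is an abelian category in which every object has finite length. Hom-finite means that each morphism set in $\mathsf C$ has finite length as a $k$-module. $\mathbb N$ contains $0$. For an additive category $\mathsf D$ with cokernels, a character for $\mathsf D$ is a function $\chi\colon \mathrm{Ob}\,\mathsf D\to\mathbb N$ such that (i) $\chi(X\oplus Y)=\chi(X)+\chi(Y)$ for all objects $X,Y$, and (ii) $\chi(X)+\chi(Z)\ge\chi(Y)$ for each exact sequence $X\to Y\to Z\to 0$ in $\mathsf D$ (i.e. $Y\to Z$ is a cokernel of $X\to Y$). A character $\chi\neq 0$ is irreducible if it cannot be written as a sum of two non-zero characters. $\mathsf{Sp}\,\mathsf D$ denotes the set of irreducible characters for $\mathsf D$. For an object $M$ of $\mathsf C$ let $\chi_M(X)=\mathrm{length}_{\mathrm{End}(M)}\mathrm{Hom}(X,M)$. A character of the form $\chi_M$ with $M$ in $\mathsf C$ is called finite. Topology on $\mathsf{Sp}\,\mathsf C$: for a morphism $\alpha\colon X\to Y$ in $\mathsf C$ set $\chi(\alpha)=\chi(X)-\chi(Y)+\chi(\mathrm{Coker}\,\alpha)$; the sets $\mathsf U_\alpha=\{\chi\in\mathsf{Sp}\,\mathsf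 C\mid\chi(\alpha)\ne 0\}$ form a basis of open sets. A full additive subcategory $\mathsf D\subseteq\mathsf C$ is subobject-closed if each subobject of an object in $\mathsf D$ belongs to $\mathsf D$. Then the inclusion $\mathsf D\to\mathsf C$ has a left adjoint $p$ (taking $X$ to $X/U$, where $U\subseteq X$ is the minimal subobject with $X/U\in\mathsf D$), so $\mathsf D$ has cokernels. The map $\mathsf{Sp}\,\mathsf D\to\mathsf{Sp}\,\mathsf C$, $\chi\mapsto\chi\circ p$, identifies $\mathsf{Sp}\,\mathsf D$ with a subset of $\mathsf{Sp}\,\mathsf C$, namely the closure of $\{\chi_M\in\mathsf{Sp}\,\mathsf C\mid M\in\mathsf D\}$. A subset $\mathsf U\subseteq\mathsf{Sp}\,\mathsf C$ is subobject-closed if $\mathsf U=\mathsf{Sp}\,\mathsf D$ for some subobject-closed full additive subcategory $\mathsf D\subseteq\mathsf C$. Intersections of subobject-closed subsets are again subobject-closed. For $\chi\in\mathsf{Sp}\,\mathsf C$, $\mathsf{sub}\,\chi$ is the intersection of all subobject-closed subsets $\mathsf U\subseteq\mathsf{Sp}\,\mathsf C$ with $\chi\in\mathsf U$. *)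

(* Defs.v *)
From HB Require Import structures.
From mathcomp Require Import all_boot all_algebra.
From mathcomp Require Import boolp classical_sets.

Set Implicit Arguments.
Unset Strict Implicit.
Unset Printing Implicit Defensive.

Import GRing.Theory.
Local Open Scope ring_scope.
Local Open Scope classical_set_scope.

(** * Length of a module *)

Definition submodule_chain (R : pzRingType) (V : lmodType R)
    (S : nat -> {pred V}) (n : nat) : Prop :=
  (forall i, (i <= n)%N -> submod_closed (S i)) /\
  (forall i, (i < n)%N ->
     {subset S i <= S i.+1} /\ ~ {subset S i.+1 <= S i}).

(* The length of V is the supremum of the lengths n of the strict chains
   S 0 < S 1 < ... < S n of submodules of V. *)
Definition has_length (R : pzRingType) (V : lmodType R) (n : nat) : Prop :=
  (exists S, submodule_chain (V := V) S n) /\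
  (forall S m, submodule_chain (V := V) S m -> (m <= n)%N).

(* The value is the junk 0 when V is not of finite length. *)
Definition length (R : pzRingType) (V : lmodType R) : nat :=
  xget 0%N [set n | has_length V n].

(** * Linear categories *)

Record lincat (k : comPzRingType) := LinCat {
  ob :> Type;
  hom : ob -> ob -> lmodType k;
  idm : forall X, hom X X;
  comp : forall X Y Z, hom Y Z -> hom X Y -> hom X Z;
  comp_idl : forall X Y (f : hom X Y), comp (idm Y) f = f;
  comp_idr : forall X Y (f : hom X Y), comp f (idm X) = f;
  comp_assoc : forall W X Y Z (h : hom Y Z) (g : hom X Y) (f : hom W X),
    comp h (comp g f) = comp (comp h g) f;
  comp_linearl : forall X Y Z (f : hom X Y),
    linear (fun g : hom Y Z => comp g f);
  comp_linearr : forall X Y Z (g : hom Y Z),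
    linear (fun f : hom X Y => comp g f)
}.
Arguments idm {k l} X.

Notation "g \oc f" := (comp g f) (at level 40, left associativity).

Section LinearCategories.
Variables (k : comPzRingType) (C : lincat k).

Definition zero_object (Z : C) : Prop :=
  (forall X (f : hom X Z), f = 0) /\ (forall X (f : hom Z X), f = 0).

Definition direct_sum (X Y S : C) : Prop :=
  exists (iX : hom X S) (iY : hom Y S) (pX : hom S X) (pY : hom S Y),
    [/\ pX \oc iX = idm X, pY \oc iY = idm Y, pX \oc iY = 0, pY \oc iX = 0
      & iX \oc pX + iY \oc pY = idm S].

Definition mono (X Y : C) (f : hom X Y) : Prop :=
  forall W (g h : hom W X), f \oc g = f \oc h -> g = h.

Definition epi (X Y : C) (f : hom X Y) : Prop :=
  forall W (g h : hom Y W), g \oc f = h \oc f -> g = h.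

Definition iso (X Y : C) (f : hom X Y) : Prop :=
  exists g : hom Y X, g \oc f = idm X /\ f \oc g = idm Y.

Definition is_kernel (X Y Z : C) (f : hom X Y) (g : hom Y Z) : Prop :=
  g \oc f = 0 /\
  (forall W (h : hom W Y), g \oc h = 0 -> exists! h' : hom W X, f \oc h' = h).

Definition is_cokernel (X Y Z : C) (f : hom X Y) (g : hom Y Z) : Prop :=
  g \oc f = 0 /\
  (forall W (h : hom Y W), h \oc f = 0 -> exists! h' : hom Z W, h' \oc g = h).

Record abelian : Prop := Abelian {
  ab_zero : exists Z : C, zero_object Z;
  ab_sum : forall X Y : C, exists S, direct_sum X Y S;
  ab_ker : forall (Y Z : C) (g : hom Y Z), exists X (f : hom X Y),
    is_kernel f g;
  ab_coker : forall (X Y : C) (f : hom X Y), exists Z (g : hom Y Z),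
    is_cokernel f g;
  ab_mono : forall (X Y : C) (f : hom X Y), mono f ->
    exists Z (g : hom Y Z), is_kernel f g;
  ab_epi : forall (Y Z : C) (g : hom Y Z), epi g ->
    exists X (f : hom X Y), is_cokernel f g
}.

Definition simple (X : C) : Prop :=
  ~ zero_object X /\
  (forall U (f : hom U X), mono f -> zero_object U \/ iso f).

(* Existence of a composition series, built from the bottom. *)
Inductive finite_length : C -> Prop :=
| FiniteLength0 X : zero_object X -> finite_length X
| FiniteLengthS U X S (f : hom U X) (g : hom X S) :
    finite_length U -> is_kernel f g -> is_cokernel f g -> simple S ->
    finite_length X.

Definition length_category : Prop := forall X : C, finite_length X.

Definition hom_finite : Prop :=
  forall X Y : C, exists n, has_length (hom X Y) n.

(** * Characters *)

Record character (chi : C -> nat) : Prop := Character {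
  char_sum : forall X Y S, direct_sum X Y S -> chi S = (chi X + chi Y)%N;
  char_exact : forall X Y Z (f : hom X Y) (g : hom Y Z),
    is_cokernel f g -> (chi Y <= chi X + chi Z)%N
}.

Definition zero_char : C -> nat := fun=> 0%N.

Definition irreducible (chi : C -> nat) : Prop :=
  [/\ character chi, chi <> zero_char
    & ~ exists phi psi : C -> nat,
        [/\ character phi, character psi, phi <> zero_char, psi <> zero_char
          & chi = fun X => (phi X + psi X)%N]].

Definition Sp : Type := {chi : C -> nat | irreducible chi}.

(** * The characters chi_M *)

(* End(M) as a ring, with multiplication f * g the composite "f after g". *)
Definition End (M : C) : Type := hom M M.

HB.instance Definition _ (M : C) := GRing.Zmodule.on (End M).

Fact End_mulDl (M : C) :
  left_distributive (fun f g : End M => (f \oc g : End M)) +%R.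
Proof.
by move=> f g h; have := comp_linearl h 1 f g; rewrite !scale1r.
Qed.

Fact End_mulDr (M : C) :
  right_distributive (fun f g : End M => (f \oc g : End M)) +%R.
Proof.
by move=> f g h; have := comp_linearr f 1 g h; rewrite !scale1r.
Qed.

HB.instance Definition _ (M : C) := GRing.Zmodule_isPzRing.Build (End M)
  (fun h g f : End M => comp_assoc h g f) (fun f : End M => comp_idl f)
  (fun f : End M => comp_idr f) (@End_mulDl M) (@End_mulDr M).

(* Hom(X, M) as a left End(M)-module; a separate name, because [hom X M]
   already carries its k-module structure. *)
Definition EndHom (M X : C) : Type := hom X M.

HB.instance Definition _ (M X : C) := GRing.Zmodule.on (EndHom M X).

Definition End_scale (M X : C) (a : End M) (f : EndHom M X) : EndHom M X :=
  (a : hom M M) \oc (f : hom X M).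

Fact End_scaleA (M X : C) (a b : End M) (f : EndHom M X) :
  End_scale a (End_scale b f) = End_scale (a * b) f.
Proof. exact: comp_assoc. Qed.

Fact End_scale1 (M X : C) : left_id (1 : End M) (@End_scale M X).
Proof. by move=> f; apply: comp_idl. Qed.

Fact End_scaleDr (M X : C) : right_distributive (@End_scale M X) +%R.
Proof.
by move=> a f g; have := comp_linearr a 1 f g; rewrite !scale1r.
Qed.

Fact End_scaleDl (M X : C) (f : EndHom M X) :
  {morph (@End_scale M X)^~ f : a b / a + b}.
Proof.
by move=> a b; have := comp_linearl f 1 a b; rewrite !scale1r.
Qed.

HB.instance Definition _ (M X : C) :=
  GRing.Zmodule_isLmodule.Build (End M) (EndHom M X)
    (@End_scaleA M X) (@End_scale1 M X) (@End_scaleDr M X) (@End_scaleDl M X).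

Definition char_of (M : C) : C -> nat :=
  fun X => length (EndHom M X : lmodType (End M)).

Definition finite_char (chi : Sp) : Prop := exists M : C, sval chi = char_of M.

(** * Subobject-closed subcategories *)

(* A full subcategory is given by its class of objects; closure under
   arbitrary monomorphisms includes closure under isomorphism. *)
Record subobject_closed (D : set C) : Prop := SubobjectClosed {
  soc_zero : exists2 Z, zero_object Z & D Z;
  soc_sum : forall X Y S, D X -> D Y -> direct_sum X Y S -> D S;
  soc_sub : forall U X (f : hom U X), mono f -> D X -> D U
}.

Definition full_subcat (D : set C) : lincat k :=
  @LinCat k {X : C | D X} (fun X Y => hom (sval X) (sval Y))
    (fun X => idm (sval X)) (fun X Y Z g f => g \oc f)
    (fun X Y f => comp_idl f) (fun X Y f => comp_idr f)
    (fun W X Y Z h g f => comp_assoc h g f)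
    (fun X Y Z f => comp_linearl f) (fun X Y Z g => comp_linearr g).

(* p is (the object part of) a left adjoint of the inclusion of D into C,
   given by a universal arrow r : X -> p X for each X (the unit). *)
Definition left_adjoint (D : set C) (p : C -> full_subcat D) : Prop :=
  forall X : C, exists r : hom X (sval (p X)),
    forall (Y : full_subcat D) (f : hom X (sval Y)),
      exists! g : hom (p X) Y, (g : hom (sval (p X)) (sval Y)) \oc r = f.

End LinearCategories.

Section Sub.
Variables (k : comPzRingType) (C : lincat k).

(* Sp D as a subset of Sp C, via phi |-> phi \o p. *)
Definition Sp_of (D : set C) : set (Sp C) :=
  [set chi | exists (p : C -> full_subcat D) (phi : Sp (full_subcat D)),
     left_adjoint p /\ sval chi = sval phi \o p].

Definition subobject_closed_set (U : set (Sp C)) : Prop :=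
  exists D : set C, subobject_closed D /\ U = Sp_of D.

Definition sub (chi : Sp C) : set (Sp C) :=
  \bigcap_(U in [set U | subobject_closed_set U /\ U chi]) U.

Definition sub_le (chi psi : Sp C) : Prop := sub chi `<=` sub psi.

End Sub.

(* Main.v *)
Require Import Defs.
From HB Require Import structures.
From Stdlib Require Relation_Definitions.
From mathcomp Require Import all_boot all_algebra zify.
From mathcomp Require Import boolp classical_sets.
Import GRing.Theory.
Import Defs.

Set Implicit Arguments.
Unset Strict Implicit.
Unset Printing Implicit Defensive.

Local Open Scope ring_scope.
Local Open Scope classical_set_scope.

(** Write D(chi) for the class of those X for which chi(Z) < chi(X) whenever
    Z is a proper quotient of X ([reduced]); for chi = chi_M these are the
    objects cogenerated by M. Pushing quotients out and using right exactness
    shows that D(chi) is subobject-closed. As objects are noetherian, every X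
    has a smallest quotient with the same value of chi, which is its reflection
    in D(chi). Hence chi lies in Sp D(chi), and D(chi) is contained in every
    subobject-closed D with chi in Sp D ([Sp_of_reduced], [reduced_sub]).

    The finite characters in sub chi determine D(chi). An object is a direct sum
    of indecomposable ones; for M indecomposable chi_M is irreducible
    ([char_of_irreducible]), and it lies in Sp D if and only if M lies in D
    ([Sp_of_char_of]). The irreducibility rests on End(M) being local. A
    morphism j out of M that generates, in Hom(M, M), the radical of End(M)
    cuts out a quotient of Hom(M, -) on which chi_M takes the value 1. If chi_M
    is a sum of two characters, one of them vanishes on that quotient, and then
    everywhere, because every Hom(X, M) is filtered by copies of the simple
    End(M)-module.

    It remains to recover chi from D(chi) ([reduced_inj]). A character extends
    to an additive function on finitely presented functors; its value on the
    subfunctor of Hom(X, -) generated by a morphism f from X to Y is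
    rank f = chi(Y) - chi(Coker f). For two characters chi and psi the minimum
    of the sums of min(chi, psi) over the layers of the finite filtrations of
    Hom(X, -) is again additive, exactly like the infimum of two measures, so
    it is a character, and chi and psi exceed it by characters. If chi and psi
    are irreducible and different, this infimum is a summand of both, hence 0.
    So, for X with chi(X) <> 0, Hom(X, -) has a filtration with chi or psi
    vanishing on each layer, and its first term on which they do not both
    vanish is a subfunctor on which exactly one of them does
    ([irreducible_separated]). This gives a quotient Q of an object W such
    that, say, chi(W) = chi(Q) but psi(W) <> psi(Q). If D(chi) = D(psi), then
    the reflection of W factors through Q, since chi does not see the
    difference between W and Q, and therefore psi(W) = psi(Q), a
    contradiction. *)

(** * Calculus in linear categories *)

Section Linear.
Variables (k : comPzRingType) (C : lincat k).

Lemma compDl (X Y Z : C) (g h : hom Y Z) (f : hom X Y) :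
  (g + h) \oc f = g \oc f + h \oc f.
Proof. by have := comp_linearl f 1 g h; rewrite !scale1r. Qed.

Lemma compDr (X Y Z : C) (f : hom Y Z) (g h : hom X Y) :
  f \oc (g + h) = f \oc g + f \oc h.
Proof. by have := comp_linearr f 1 g h; rewrite !scale1r. Qed.

Lemma comp0l (X Y Z : C) (f : hom X Y) : (0 : hom Y Z) \oc f = 0.
Proof. by apply: (addrI (0 \oc f)); rewrite -compDl !addr0. Qed.

Lemma comp0r (X Y Z : C) (f : hom Y Z) : f \oc (0 : hom X Y) = 0.
Proof. by apply: (addrI (f \oc 0)); rewrite -compDr !addr0. Qed.

Lemma compNl (X Y Z : C) (g : hom Y Z) (f : hom X Y) :
  (- g) \oc f = - (g \oc f).
Proof. by apply: (addrI (g \oc f)); rewrite -compDl !subrr comp0l. Qed.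

Lemma compNr (X Y Z : C) (f : hom Y Z) (g : hom X Y) :
  f \oc (- g) = - (f \oc g).
Proof. by apply: (addrI (f \oc g)); rewrite -compDr !subrr comp0r. Qed.

Lemma compBl (X Y Z : C) (g h : hom Y Z) (f : hom X Y) :
  (g - h) \oc f = g \oc f - h \oc f.
Proof. by rewrite compDl compNl. Qed.

Lemma compBr (X Y Z : C) (f : hom Y Z) (g h : hom X Y) :
  f \oc (g - h) = f \oc g - f \oc h.
Proof. by rewrite compDr compNr. Qed.

Lemma compZl (X Y Z : C) (a : k) (g : hom Y Z) (f : hom X Y) :
  (a *: g) \oc f = a *: (g \oc f).
Proof. by have := comp_linearl f a g 0; rewrite !addr0 comp0l addr0. Qed.

Lemma mono_ker0 (X Y : C) (f : hom X Y) :
  (forall W (g : hom W X), f \oc g = 0 -> g = 0) -> mono f.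
Proof.
move=> f0 W g h /eqP; rewrite -subr_eq0 -compBr => /eqP /f0 /eqP.
by rewrite subr_eq0 => /eqP.
Qed.

Lemma mono_eq0 (X Y W : C) (f : hom X Y) (g : hom W X) :
  mono f -> f \oc g = 0 -> g = 0.
Proof. by move=> fmono fg0; apply: fmono; rewrite fg0 comp0r. Qed.

Lemma epi_coker0 (X Y : C) (f : hom X Y) :
  (forall W (g : hom Y W), g \oc f = 0 -> g = 0) -> epi f.
Proof.
move=> f0 W g h /eqP; rewrite -subr_eq0 -compBl => /eqP /f0 /eqP.
by rewrite subr_eq0 => /eqP.
Qed.

Lemma epi_eq0 (X Y W : C) (f : hom X Y) (g : hom Y W) :
  epi f -> g \oc f = 0 -> g = 0.
Proof. by move=> fepi gf0; apply: fepi; rewrite gf0 comp0l. Qed.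

Lemma mono_comp (X Y Z : C) (g : hom Y Z) (f : hom X Y) :
  mono g -> mono f -> mono (g \oc f).
Proof.
by move=> gm fm W a b; rewrite -!comp_assoc => /gm /fm.
Qed.

Lemma mono_cancel (X Y Z : C) (g : hom Y Z) (f : hom X Y) :
  mono (g \oc f) -> mono f.
Proof. by move=> gfm W a b e; apply: gfm; rewrite -!comp_assoc e. Qed.

Lemma epi_comp (X Y Z : C) (g : hom Y Z) (f : hom X Y) :
  epi g -> epi f -> epi (g \oc f).
Proof.
by move=> ge fe W a b; rewrite !comp_assoc => /fe /ge.
Qed.

Lemma epi_cancel (X Y Z : C) (g : hom Y Z) (f : hom X Y) :
  epi (g \oc f) -> epi g.
Proof. by move=> gfe W a b e; apply: gfe; rewrite !comp_assoc e. Qed.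

Lemma idm_mono (X : C) : mono (idm X).
Proof. by move=> W a b; rewrite !comp_idl. Qed.

Lemma idm_epi (X : C) : epi (idm X).
Proof. by move=> W a b; rewrite !comp_idr. Qed.

Lemma iso_epi (X Y : C) (f : hom X Y) : iso f -> epi f.
Proof.
case=> g [_ fg]; apply: (@epi_cancel _ _ _ f g); rewrite fg.
exact: idm_epi.
Qed.

Lemma coker_epi (X Y Z : C) (f : hom X Y) (g : hom Y Z) :
  is_cokernel f g -> epi g.
Proof.
case=> gf0 gU; apply: epi_coker0 => W h hg0.
have [|h' [_ hU]] := gU W 0; first by rewrite comp0l.
by rewrite -(hU h) // -(hU 0) // comp0l.
Qed.

Lemma ker_mono (X Y Z : C) (f : hom X Y) (g : hom Y Z) :
  is_kernel f g -> mono f.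
Proof.
case=> gf0 gU; apply: mono_ker0 => W h hg0.
have [|h' [_ hU]] := gU W 0; first by rewrite comp0r.
by rewrite -(hU h) // -(hU 0) // comp0r.
Qed.

Lemma coker_factor (X Y Z W : C) (f : hom X Y) (g : hom Y Z) (h : hom Y W) :
  is_cokernel f g -> h \oc f = 0 -> exists h', h' \oc g = h.
Proof. by case=> _ U /U [h' [<- _]]; exists h'. Qed.

Lemma ker_factor (X Y Z W : C) (f : hom X Y) (g : hom Y Z) (h : hom W Y) :
  is_kernel f g -> g \oc h = 0 -> exists h', f \oc h' = h.
Proof. by case=> _ U /U [h' [<- _]]; exists h'. Qed.

Lemma is_cokernel_intro (X Y Z : C) (f : hom X Y) (g : hom Y Z) :
  g \oc f = 0 -> epi g ->
  (forall W (h : hom Y W), h \oc f = 0 -> exists h', h' \oc g = h) ->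
  is_cokernel f g.
Proof.
move=> gf0 ge U; split=> // W h /U [h' h'g]; exists h'; split=> // h'' h''g.
by apply: ge; rewrite h'g.
Qed.

Lemma zero_object_idm (X : C) : idm X = 0 -> zero_object X.
Proof.
move=> id0; split=> Y f.
  by rewrite -(comp_idl f) id0 comp0l.
by rewrite -(comp_idr f) id0 comp0r.
Qed.

Lemma direct_sum_ext (X Y S W : C) (iX : hom X S) (iY : hom Y S)
    (pX : hom S X) (pY : hom S Y) (f g : hom S W) :
  iX \oc pX + iY \oc pY = idm S ->
  f \oc iX = g \oc iX -> f \oc iY = g \oc iY -> f = g.
Proof.
move=> id_S fgX fgY; rewrite -(comp_idr f) -(comp_idr g) -id_S !compDr.
by rewrite !comp_assoc fgX fgY.
Qed.

Lemma direct_sum_coker (X Y S : C) (iX : hom X S) (iY : hom Y S)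
    (pX : hom S X) (pY : hom S Y) :
  pY \oc iY = idm Y -> pY \oc iX = 0 -> iX \oc pX + iY \oc pY = idm S ->
  is_cokernel iX pY.
Proof.
move=> eY eYX eS; apply: is_cokernel_intro => // [|W h hiX].
  by apply: (@epi_cancel _ _ _ pY iY); rewrite eY; apply: idm_epi.
exists (h \oc iY); rewrite -{2}(comp_idr h) -eS compDr !comp_assoc hiX.
by rewrite comp0l add0r.
Qed.

Lemma direct_sum0 (X Z : C) : zero_object Z -> direct_sum X Z X.
Proof.
move=> [Z0l Z0r]; exists (idm X), 0, (idm X), 0.
by split; rewrite ?comp_idl ?comp0l ?comp0r ?addr0 // (Z0r _ (idm Z)).
Qed.

Lemma zero_coker (X Y Z : C) (q : hom X Y) (z : hom Y Z) :
  zero_object Z -> epi q -> is_cokernel q z.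
Proof.
move=> [Z0l Z0r] qe; apply: is_cokernel_intro.
- by rewrite (Z0l _ z) comp0l.
- by apply: epi_coker0 => W g _; apply: Z0r.
- by move=> W h /(epi_eq0 qe) ->; exists 0; rewrite comp0l.
Qed.

(** * Pushouts *)

Definition pushout (X W M P : C) (a : hom X W) (v : hom X M)
    (u : hom W P) (w : hom M P) : Prop :=
  [/\ u \oc a = w \oc v,
      forall E (s : hom W E) (t : hom M E), s \oc a = t \oc v ->
        exists2 h : hom P E, h \oc u = s & h \oc w = t
    & forall E (h h' : hom P E), h \oc u = h' \oc u -> h \oc w = h' \oc w ->
        h = h'].

Lemma pushout_sym (X W M P : C) (a : hom X W) (v : hom X M)
    (u : hom W P) (w : hom M P) : pushout a v u w -> pushout v a w u.
Proof.
case=> [sq ex un]; split=> [//|E s t /esym /ex [h hu hw]|E h h' hw hu].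
  by exists h.
exact: un.
Qed.

Lemma pushout_id (X Y : C) (f : hom X Y) : pushout (idm X) f f (idm Y).
Proof.
split=> [|E s t|E h h' _]; rewrite ?comp_idl ?comp_idr //.
by move=> ->; exists t; rewrite ?comp_idr.
Qed.

(** This is how right exactness of a character and additivity on direct sums
    apply to pushout squares. *)
Lemma pushout_cokernel (X W M P S : C) (a : hom X W) (v : hom X M)
    (u : hom W P) (w : hom M P) (iW : hom W S) (iM : hom M S)
    (pW : hom S W) (pM : hom S M) :
  [/\ pW \oc iW = idm W, pM \oc iM = idm M, pW \oc iM = 0, pM \oc iW = 0
    & iW \oc pW + iM \oc pM = idm S] ->
  pushout a v u w ->
  is_cokernel (iW \oc a + iM \oc v) (u \oc pW - w \oc pM).
Proof.
move=> [eW eM eWM eMW eS] [sq ex un].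
have uwW : (u \oc pW - w \oc pM) \oc iW = u.
  by rewrite compBl -!comp_assoc eW eMW comp0r comp_idr subr0.
have uwM : (u \oc pW - w \oc pM) \oc iM = - w.
  by rewrite compBl -!comp_assoc eM eWM comp0r comp_idr sub0r.
apply: is_cokernel_intro.
- by rewrite compDr !comp_assoc uwW uwM compNl sq subrr.
- apply: epi_coker0 => E h h0; apply: un.
    by rewrite -uwW !comp_assoc h0 !comp0l.
  apply: oppr_inj; rewrite comp0l oppr0 -compNr -uwM comp_assoc h0.
  by rewrite comp0l.
- move=> E h; rewrite compDr !comp_assoc => /eqP; rewrite addr_eq0 => /eqP.
  rewrite -(compNl (h \oc iM)) => e; have [h' h'u h'w] := ex _ _ _ e; exists h'.
  apply: (direct_sum_ext eS); rewrite -comp_assoc ?uwW ?uwM //.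
  by rewrite compNr h'w opprK.
Qed.

(** If Q and Q' are the cokernels of b and of c b, then Q' is the pushout of
    Q along c: a quotient of a quotient. *)
Lemma coker_comp_pushout (X Y Z Q Q' : C) (b : hom X Y) (c : hom Y Z)
    (q : hom Y Q) (q' : hom Z Q') (t : hom Q Q') :
  is_cokernel b q -> is_cokernel (c \oc b) q' -> t \oc q = q' \oc c ->
  pushout c q q' t.
Proof.
move=> bq cbq' tq; split=> [//|E s r sc|E h h' e1 _].
- have [|h hq'] := coker_factor (h := s) cbq'.
    by rewrite comp_assoc sc -comp_assoc bq.1 comp0r.
  exists h => //; apply: (coker_epi bq).
  by rewrite -comp_assoc tq comp_assoc hq'.
- exact: (coker_epi cbq').
Qed.

(** A map out of P that kills w is determined by its composite with u, which
    kills a. *)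
Lemma pushout_coker (X W M P Q : C) (a : hom X W) (v : hom X M)
    (u : hom W P) (w : hom M P) (q : hom W Q) :
  pushout a v u w -> is_cokernel a q ->
  exists t : hom P Q, [/\ t \oc u = q, t \oc w = 0 & is_cokernel w t].
Proof.
move=> [sq ex un] aq.
have [|t tu tw] := ex _ q 0; first by rewrite aq.1 comp0l.
exists t; split=> //; apply: is_cokernel_intro => //.
  by apply: (@epi_cancel _ _ _ t u); rewrite tu; apply: coker_epi aq.
move=> E h hw0; have [|h' h'q] := coker_factor (h := h \oc u) aq.
  by rewrite -comp_assoc sq comp_assoc hw0 comp0l.
exists h'; apply: un; first by rewrite -comp_assoc tu.
by rewrite hw0 -comp_assoc tw comp0r.
Qed.

(** A map out of P that kills the diagonal amounts to a map out of W that kills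
    a and a map out of M that kills v. *)
Lemma pushout_diag_coker (X W M P Q R T : C) (a : hom X W) (v : hom X M)
    (u : hom W P) (w : hom M P) (q : hom W Q) (r : hom M R) :
  pushout a v u w -> is_cokernel a q -> is_cokernel v r ->
  direct_sum Q R T -> exists t : hom P T, is_cokernel (u \oc a) t.
Proof.
move=> po aq vr [iQ [iR [pQ [pR [eQ eR eQR eRQ eT]]]]].
have [tq [tqu tqw _]] := pushout_coker po aq.
have [tr [trw tru _]] := pushout_coker (pushout_sym po) vr.
have tE1 : (iQ \oc tq + iR \oc tr) \oc u = iQ \oc q.
  by rewrite compDl -!comp_assoc tqu tru comp0r addr0.
have tE2 : (iQ \oc tq + iR \oc tr) \oc w = iR \oc r.
  by rewrite compDl -!comp_assoc tqw trw comp0r add0r.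
case: po => sq ex un.
exists (iQ \oc tq + iR \oc tr); apply: is_cokernel_intro.
- by rewrite comp_assoc tE1 -comp_assoc aq.1 comp0r.
- move=> E h h' e; apply: (direct_sum_ext eT).
    by apply: (coker_epi aq); rewrite -!comp_assoc -tE1 !comp_assoc e.
  by apply: (coker_epi vr); rewrite -!comp_assoc -tE2 !comp_assoc e.
- move=> E h hua.
  have [|s sq'] := coker_factor (h := h \oc u) aq; first by rewrite -comp_assoc.
  have [|s' s'r] := coker_factor (h := h \oc w) vr.
    by rewrite -comp_assoc -sq.
  exists (s \oc pQ + s' \oc pR); apply: un.
    rewrite -comp_assoc tE1 compDl !comp_assoc -!(comp_assoc _ _ iQ) eQ eRQ.
    by rewrite comp_idr comp0r comp0l addr0.
  rewrite -comp_assoc tE2 compDl !comp_assoc -!(comp_assoc _ _ iR) eR eQR.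
  by rewrite comp_idr comp0r comp0l add0r.
Qed.

End Linear.

(** * Characters and ranks of morphisms *)

Section Characters.
Variables (k : comPzRingType) (C : lincat k) (chi : C -> nat).
Hypothesis chiC : character chi.

Lemma char_zero (Z : C) : zero_object Z -> chi Z = 0%N.
Proof. by move=> Z0; have := char_sum chiC (direct_sum0 Z Z0); lia. Qed.

Hypothesis has_zero : exists Z : C, zero_object Z.

Lemma char_epi (X Y : C) (q : hom X Y) : epi q -> (chi Y <= chi X)%N.
Proof.
move=> qe; have [O O0] := has_zero.
by have := char_exact chiC (zero_coker 0 O0 qe); rewrite (char_zero O0) addn0.
Qed.

Lemma char_iso (X Y : C) (f : hom X Y) : iso f -> chi X = chi Y.
Proof.
move=> fi; have fe := iso_epi fi; case: fi => g [gf fg].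
have ge : epi g by apply: iso_epi; exists f.
by apply/eqP; rewrite eqn_leq !(char_epi fe) (char_epi ge).
Qed.

Lemma char_coker (X Y Z Z' : C) (f : hom X Y) (g : hom Y Z) (g' : hom Y Z') :
  is_cokernel f g -> is_cokernel f g' -> chi Z = chi Z'.
Proof.
move=> fg fg'.
have [h hg] := coker_factor fg fg'.1; have [h' h'g] := coker_factor fg' fg.1.
have he : epi h.
  by apply: (@epi_cancel _ _ _ _ _ h g); rewrite hg; apply: coker_epi fg'.
have h'e : epi h'.
  by apply: (@epi_cancel _ _ _ _ _ h' g'); rewrite h'g; apply: coker_epi fg.
by apply/eqP; rewrite eqn_leq !(char_epi he) (char_epi h'e).
Qed.

End Characters.

Section Rank.
Variables (k : comPzRingType) (C : lincat k).
Hypothesis Cab : abelian C.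

Lemma pushout_ex (X W M : C) (a : hom X W) (v : hom X M) :
  exists (P : C) (u : hom W P) (w : hom M P), pushout a v u w.
Proof.
have [S [iW [iM [pW [pM [eW eM eWM eMW eS]]]]]] := ab_sum Cab W M.
have [P [q cq]] := ab_coker Cab (iW \oc a - iM \oc v).
exists P, (q \oc iW), (q \oc iM); split.
- by apply/eqP; rewrite -!comp_assoc -subr_eq0 -compBr cq.1.
- move=> E s t e; have [|h hq] := coker_factor (h := s \oc pW + t \oc pM) cq.
    rewrite compDl !compBr -!comp_assoc !(comp_assoc pW) !(comp_assoc pM).
    by rewrite eW eM eWM eMW !comp0l !comp_idl !comp0r subr0 sub0r e subrr.
  exists h; rewrite comp_assoc hq compDl -!comp_assoc ?eW ?eM ?eWM ?eMW.
    by rewrite comp_idr comp0r addr0.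
  by rewrite comp_idr comp0r add0r.
- move=> E h h' e1 e2; apply: (coker_epi cq).
  by apply: (direct_sum_ext eS); rewrite -!comp_assoc.
Qed.

Lemma tagged_coker_ex (X Y : C) (f : hom X Y) :
  exists Zq : {Z : C & hom Y Z}, is_cokernel f (projT2 Zq).
Proof. by have [Z [q fq]] := ab_coker Cab f; exists (existT _ Z q). Qed.

Definition coker (X Y : C) (f : hom X Y) : C :=
  projT1 (projT1 (cid (tagged_coker_ex f))).

(** For chi = chi_M this is the length of the image of the map from Hom(Y, M)
    to Hom(X, M) induced by f. In general it is the value of chi at the
    subfunctor of Hom(X, -) generated by f. *)
Definition rank (chi : C -> nat) (X Y : C) (f : hom X Y) : nat :=
  (chi Y - chi (coker f))%N.

Section OneCharacter.
Variable chi : C -> nat.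
Hypothesis chiC : character chi.
Let zC := ab_zero Cab.

Lemma rank_coker (X Y Z : C) (f : hom X Y) (q : hom Y Z) :
  is_cokernel f q -> (rank chi f + chi Z = chi Y)%N.
Proof.
move=> fq; rewrite /rank /coker; case: cid => -[Z' q'] /= fq'.
rewrite (char_coker chiC zC fq' fq) subnK //.
exact: (char_epi chiC zC (coker_epi fq)).
Qed.

Lemma rank_pair (X W M P S : C) (a : hom X W) (v : hom X M)
    (u : hom W P) (w : hom M P) (iW : hom W S) (iM : hom M S)
    (pW : hom S W) (pM : hom S M) :
  [/\ pW \oc iW = idm W, pM \oc iM = idm M, pW \oc iM = 0, pM \oc iW = 0
    & iW \oc pW + iM \oc pM = idm S] ->
  pushout a v u w ->
  (rank chi (iW \oc a + iM \oc v) + chi P = chi W + chi M)%N.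
Proof.
move=> eS po; rewrite (rank_coker (pushout_cokernel eS po)).
by apply: (char_sum chiC); exists iW, iM, pW, pM.
Qed.

Lemma char_pushout (X W M P : C) (a : hom X W) (v : hom X M)
    (u : hom W P) (w : hom M P) :
  pushout a v u w -> (chi W + chi M <= chi X + chi P)%N.
Proof.
move=> po; have [S [iW [iM [pW [pM eS]]]]] := ab_sum Cab W M.
rewrite -(@char_sum _ _ _ chiC W M S); last by exists iW, iM, pW, pM.
exact: (char_exact chiC (pushout_cokernel eS po)).
Qed.

Lemma rank_idm (X : C) : rank chi (idm X) = chi X.
Proof.
have [O O0] := zC; have := rank_coker (zero_coker 0 O0 (idm_epi (X := X))).
by rewrite (char_zero chiC O0); lia.
Qed.

Lemma rank0 (X Y : C) : rank chi (0 : hom X Y) = 0%N.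
Proof.
have c : is_cokernel (0 : hom X Y) (idm Y).
  apply: is_cokernel_intro => [||W h _]; first by rewrite comp0r.
    exact: idm_epi.
  by exists h; rewrite comp_idr.
by have := rank_coker c; lia.
Qed.

Lemma rank_comp_le (X Y Z : C) (f : hom X Y) (g : hom Y Z) :
  (rank chi (g \oc f) <= rank chi f)%N.
Proof.
have [Q [q fq]] := ab_coker Cab f; have [Q' [q' gfq]] := ab_coker Cab (g \oc f).
have [|t tq] := coker_factor (h := q' \oc g) fq.
  by rewrite -comp_assoc gfq.1.
have := char_pushout (coker_comp_pushout fq gfq tq).
by have := rank_coker fq; have := rank_coker gfq; lia.
Qed.

(** Rank-nullity for the restriction along f: the part of the subfunctor
    generated by a which dies on X is generated by s c. *)
Lemma rank_nullity (X Y Z W Q : C) (f : hom X Y) (c : hom Y Z) (a : hom Y W)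
    (q : hom W Q) (s : hom Z Q) :
  is_cokernel f c -> is_cokernel (a \oc f) q -> s \oc c = q \oc a ->
  rank chi a = (rank chi (a \oc f) + rank chi s)%N.
Proof.
move=> fc afq sc; have po := coker_comp_pushout fc afq sc.
have [R [r ar]] := ab_coker Cab a.
have [t [_ _ st]] := pushout_coker po ar.
by have := rank_coker ar; have := rank_coker st; have := rank_coker afq; lia.
Qed.

Lemma rank_diag (X W M P S : C) (a : hom X W) (v : hom X M)
    (u : hom W P) (w : hom M P) (iW : hom W S) (iM : hom M S)
    (pW : hom S W) (pM : hom S M) :
  [/\ pW \oc iW = idm W, pM \oc iM = idm M, pW \oc iM = 0, pM \oc iW = 0
    & iW \oc pW + iM \oc pM = idm S] ->
  pushout a v u w ->
  (rank chi (u \oc a) + rank chi (iW \oc a + iM \oc v)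
     = rank chi a + rank chi v)%N.
Proof.
move=> eS po; have := rank_pair eS po.
have [Q [q aq]] := ab_coker Cab a; have [R [r vr]] := ab_coker Cab v.
have [T QRT] := ab_sum Cab Q R.
have [t uat] := pushout_diag_coker po aq vr QRT.
have := rank_coker uat; rewrite (char_sum chiC QRT).
by have := rank_coker aq; have := rank_coker vr; lia.
Qed.

(** The subfunctors generated by a and v intersect in the one generated by the
    diagonal u a of their pushout. Enlarging the first one from ga to a thus
    enlarges the intersection by no more. *)
Lemma rank_diag_mono (X W W' M P P' : C) (a : hom X W) (g : hom W W')
    (v : hom X M) (u : hom W P) (w : hom M P) (u' : hom W' P')
    (w' : hom M P') :
  pushout a v u w -> pushout (g \oc a) v u' w' ->
  (rank chi (u \oc a) + rank chi (g \oc a)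
     <= rank chi (u' \oc (g \oc a)) + rank chi a)%N.
Proof.
move=> po po'.
have [S [iW [iM [pW [pM eS]]]]] := ab_sum Cab W M.
have [S' [iW' [iM' [pW' [pM' eS']]]]] := ab_sum Cab W' M.
have := rank_diag eS po; have := rank_diag eS' po'.
have := rank_comp_le (iW \oc a + iM \oc v) (iW' \oc g \oc pW + iM' \oc pM).
have -> : (iW' \oc g \oc pW + iM' \oc pM) \oc (iW \oc a + iM \oc v)
          = iW' \oc (g \oc a) + iM' \oc v.
  case: eS => [eW eM eWM eMW _].
  rewrite compDl !compDr -!comp_assoc !(comp_assoc pW) !(comp_assoc pM).
  by rewrite eW eM eWM eMW !comp0l !comp_idl !comp0r addr0 add0r.
by lia.
Qed.

End OneCharacter.

End Rank.

(** * The infimum of two characters *)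

Section Infimum.
Variables (k : comPzRingType) (C : lincat k).
Hypothesis Cab : abelian C.
Let zC := ab_zero Cab.
Variables chi psi : C -> nat.
Hypotheses (chiC : character chi) (psiC : character psi).

Local Notation rchi := (rank Cab chi).
Local Notation rpsi := (rank Cab psi).

(** A sequence of morphisms from the target of a, whose composite with a
    vanishes, is a finite filtration of the subfunctor of Hom(X, -) generated
    by a. Its cost is the sum, over the layers, of the smaller of the two
    values of chi and psi. *)
Inductive filtration (X : C) : forall W, hom X W -> nat -> Prop :=
| Filtration0 W : filtration (0 : hom X W) 0
| FiltrationS W W' (a : hom X W) (g : hom W W') n :
    filtration (g \oc a) n ->
    filtration a (minn (rchi a - rchi (g \oc a)) (rpsi a - rpsi (g \oc a)) + n).

Lemma filtration_ex (X W : C) (a : hom X W) : exists n, `[< filtration a n >].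
Proof.
eexists; apply/asboolP; apply: (@FiltrationS _ _ W a 0 0).
by rewrite comp0l; constructor.
Qed.

Definition infimum (X W : C) (a : hom X W) : nat := ex_minn (filtration_ex a).

Lemma infimum_filtration (X W : C) (a : hom X W) : filtration a (infimum a).
Proof. by rewrite /infimum; case: ex_minnP => n /asboolP. Qed.

Lemma infimum_le (X W : C) (a : hom X W) n :
  filtration a n -> (infimum a <= n)%N.
Proof.
by move=> an; rewrite /infimum; case: ex_minnP => m _; apply; apply/asboolP.
Qed.

Lemma infimum_step (X W W' : C) (a : hom X W) (g : hom W W') :
  (infimum a <= minn (rchi a - rchi (g \oc a)) (rpsi a - rpsi (g \oc a))
                + infimum (g \oc a))%N.
Proof. by apply: infimum_le; apply: FiltrationS; apply: infimum_filtration. Qed.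

(** Intersecting a filtration with the subfunctor generated by f does not
    increase its cost. *)
Lemma infimum_diag (X W : C) (a : hom X W) n : filtration a n ->
  forall (Y P : C) (f : hom X Y) (u : hom W P) (w : hom Y P),
    pushout a f u w -> (infimum (u \oc a) <= n)%N.
Proof.
elim=> {W a n} [W|W W' a g n _ IH] Y P f u w po.
  by rewrite comp0r; apply: infimum_le; constructor.
have [P' [u' [w' po']]] := pushout_ex Cab (g \oc a) f.
have le_chi := rank_diag_mono Cab chiC po po'.
have le_psi := rank_diag_mono Cab psiC po po'.
have [sq ex _] := po; have [|t tu tw] := ex _ (u' \oc g) w'.
  by rewrite -comp_assoc; case: po'.
have := infimum_step (u \oc a) t; rewrite comp_assoc tu -comp_assoc.
have := IH _ _ _ _ _ po'; have := rank_comp_le Cab chiC a g.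
have := rank_comp_le Cab psiC a g; rewrite /minn; case: ifP; case: ifP; lia.
Qed.

Lemma infimum_le_source (X Y : C) (f : hom X Y) :
  (infimum f <= infimum (idm X))%N.
Proof.
have := infimum_diag (infimum_filtration (idm X)) (pushout_id f).
by rewrite comp_idr.
Qed.

(** A filtration on Y restricts along f to one of the subfunctor generated by
    f, and induces one on the cokernel Z of f; a minimum of sums is at least
    the sum of the minima. *)
Lemma infimum_nullity_ge (X Y Z : C) (f : hom X Y) (c : hom Y Z) :
  is_cokernel f c ->
  forall W (a : hom Y W) n, filtration a n ->
  forall Q (q : hom W Q) (s : hom Z Q),
    is_cokernel (a \oc f) q -> s \oc c = q \oc a ->
    (infimum (a \oc f) + infimum s <= n)%N.
Proof.
move=> fc W a n; elim=> {W a n} [W|W W' a g n _ IH] Q q s afq sc.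
  have -> : s = 0 by apply: (epi_eq0 (coker_epi fc)); rewrite sc comp0r.
  have i0 (A B : C) : infimum (0 : hom A B) = 0%N.
    by apply/eqP; rewrite -leqn0; apply: infimum_le; constructor.
  by rewrite comp0l !i0.
have [Q' [q' gafq']] := ab_coker Cab (g \oc a \oc f).
have [|t tq] := coker_factor (h := q' \oc g) afq.
  by rewrite -comp_assoc comp_assoc -comp_assoc (comp_assoc g) gafq'.1.
have sc' : (t \oc s) \oc c = q' \oc (g \oc a).
  by rewrite -comp_assoc sc comp_assoc tq comp_assoc.
have := IH _ _ _ gafq' sc'.
have := infimum_step (a \oc f) g; have := infimum_step s t.
rewrite comp_assoc.
have := rank_nullity Cab chiC fc afq sc.
have := rank_nullity Cab psiC fc afq sc.
have := rank_nullity Cab chiC fc gafq' sc'.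
have := rank_nullity Cab psiC fc gafq' sc'.
have := rank_comp_le Cab chiC (a \oc f) g.
have := rank_comp_le Cab psiC (a \oc f) g; rewrite comp_assoc.
have := rank_comp_le Cab chiC s t.
have := rank_comp_le Cab psiC s t.
rewrite /minn; do 3!case: ifP; lia.
Qed.

Lemma filtration_coker (X Y Z : C) (f : hom X Y) (c : hom Y Z) :
  is_cokernel f c -> forall W (b : hom Z W) n, filtration b n ->
  filtration (b \oc c) n.
Proof.
move=> fc.
have rankc phi (phiC : character phi) W (b : hom Z W) :
    rank Cab phi (b \oc c) = rank Cab phi b.
  have [Q [q bq]] := ab_coker Cab b.
  suff bcq : is_cokernel (b \oc c) q.
    by have := rank_coker Cab phiC bq; have := rank_coker Cab phiC bcq; lia.
  apply: is_cokernel_intro => [||E h].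
  - by rewrite comp_assoc bq.1 comp0l.
  - exact: coker_epi bq.
  - by rewrite comp_assoc => /(epi_eq0 (coker_epi fc)); apply: coker_factor bq.
move=> W b n; elim=> {W b n} [W|W W' b g n _ IH].
  by rewrite comp0l; constructor.
have := FiltrationS (a := b \oc c) (g := g) (n := n).
by rewrite comp_assoc !rankc //; apply.
Qed.

(** Conversely, a filtration on Z and one of the subfunctor generated by f
    are spliced into one on Y, with layers generated by the pairs (g, c) for
    g f running through the latter. *)
Lemma infimum_nullity_le (X Y Z : C) (f : hom X Y) (c : hom Y Z) :
  is_cokernel f c ->
  forall W (d : hom X W) n, filtration d n ->
  forall (g : hom Y W) S (iW : hom W S) (iZ : hom Z S) (pW : hom S W)
    (pZ : hom S Z),
    [/\ pW \oc iW = idm W, pZ \oc iZ = idm Z, pW \oc iZ = 0, pZ \oc iW = 0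
      & iW \oc pW + iZ \oc pZ = idm S] ->
    d = g \oc f ->
    (infimum (iW \oc g + iZ \oc c) <= n + infimum (idm Z))%N.
Proof.
move=> fc.
have rank_pc phi (phiC : character phi) W (g : hom Y W) S (iW : hom W S)
    (iZ : hom Z S) (pW : hom S W) (pZ : hom S Z) :
    [/\ pW \oc iW = idm W, pZ \oc iZ = idm Z, pW \oc iZ = 0, pZ \oc iW = 0
      & iW \oc pW + iZ \oc pZ = idm S] ->
    rank Cab phi (iW \oc g + iZ \oc c) = (rank Cab phi (g \oc f) + phi Z)%N.
  move=> eS; have [Q [q gfq]] := ab_coker Cab (g \oc f).
  have [|t tc] := coker_factor (h := q \oc g) fc.
    by rewrite -comp_assoc gfq.1.
  have := rank_pair Cab phiC eS (coker_comp_pushout fc gfq tc).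
  by have := rank_coker Cab phiC gfq; lia.
move=> W d n; elim=> {W d n} [W|W W' d g' n _ IH] g S iW iZ pW pZ eS.
  move=> /esym gf0.
  have := infimum_step (iW \oc g + iZ \oc c) pZ.
  have := infimum_le (filtration_coker fc (infimum_filtration (idm Z))).
  rewrite comp_idl; have -> : pZ \oc (iW \oc g + iZ \oc c) = c.
    case: eS => [_ eZ _ eZW _].
    by rewrite compDr !comp_assoc eZ eZW comp0l comp_idl add0r.
  rewrite !(rank_pc _ _ _ _ _ _ _ _ _ eS) // gf0 !rank0 // !add0n.
  have rc phi : character phi -> rank Cab phi c = phi Z.
    move=> phiC; have [O O0] := zC.
    have := rank_coker Cab phiC (zero_coker 0 O0 (coker_epi fc)).
    by rewrite (char_zero phiC O0); lia.
  by rewrite !rc // !subnn minnn; lia.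
move=> dgf; have [S' [iW' [iZ' [pW' [pZ' eS']]]]] := ab_sum Cab W' Z.
have := IH (g' \oc g) _ _ _ _ _ eS'; rewrite -comp_assoc -dgf => /(_ erefl).
have := infimum_step (iW \oc g + iZ \oc c) (iW' \oc g' \oc pW + iZ' \oc pZ).
have -> : (iW' \oc g' \oc pW + iZ' \oc pZ) \oc (iW \oc g + iZ \oc c)
          = iW' \oc (g' \oc g) + iZ' \oc c.
  case: eS => [eW eZ eWZ eZW _].
  rewrite compDl !compDr -!comp_assoc !(comp_assoc pW) !(comp_assoc pZ).
  by rewrite eW eZ eWZ eZW !comp0l !comp_idl !comp0r addr0 add0r.
rewrite !(rank_pc _ _ _ _ _ _ _ _ _ eS) // !(rank_pc _ _ _ _ _ _ _ _ _ eS') //.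
rewrite -!comp_assoc -!dgf !subnDr; lia.
Qed.

Lemma infimum_nullity (X Y Z : C) (f : hom X Y) (c : hom Y Z) :
  is_cokernel f c -> infimum (idm Y) = (infimum f + infimum (idm Z))%N.
Proof.
move=> fc; apply/eqP; rewrite eqn_leq; apply/andP; split; last first.
  have := infimum_nullity_ge fc (infimum_filtration (idm Y)) (q := c)
    (s := idm Z).
  by rewrite !comp_idl comp_idr; apply.
have [S [iY [iZ [pY [pZ eS]]]]] := ab_sum Cab Y Z.
have := infimum_nullity_le fc (infimum_filtration f) eS (esym (comp_idl f)).
have := infimum_step (idm Y) (iY \oc idm Y + iZ \oc c).
rewrite comp_idr !rank_idm //.
(* The pair (id, c) is a split monomorphism, so it has full rank. *)
have split_rank phi (phiC : character phi) :
    (phi Y <= rank Cab phi (iY \oc idm Y + iZ \oc c))%N.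
  rewrite -(rank_idm Cab phiC).
  have -> : idm Y = pY \oc (iY \oc idm Y + iZ \oc c).
    case: eS => [eY _ eYZ _ _].
    by rewrite compDr !comp_assoc eY eYZ comp0l comp_idl addr0.
  rewrite {2}(_ : pY \oc _ = idm Y); first exact: rank_comp_le.
  case: eS => [eY _ eYZ _ _].
  by rewrite compDr !comp_assoc eY eYZ comp0l comp_idl addr0.
have := split_rank _ chiC; have := split_rank _ psiC; lia.
Qed.

Definition infimum_char (X : C) : nat := infimum (idm X).

Lemma infimum_char_le (X : C) :
  (infimum_char X <= chi X)%N /\ (infimum_char X <= psi X)%N.
Proof.
have := infimum_step (idm X) (0 : hom X X).
rewrite comp0l !rank0 // !rank_idm // !subn0 /infimum_char.
have : (infimum (0 : hom X X) <= 0)%N by apply: infimum_le; constructor.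
lia.
Qed.

(** The defect of additivity of each of chi, psi and their infimum is its value
    on the quotient of Hom(X, -) by the subfunctor generated by f. *)
Lemma infimum_char_exact (X Y Z : C) (f : hom X Y) (c : hom Y Z) :
  is_cokernel f c ->
  [/\ (infimum_char Y <= infimum_char X + infimum_char Z)%N,
      (infimum_char X + infimum_char Z + chi Y
         <= infimum_char Y + chi X + chi Z)%N
    & (infimum_char X + infimum_char Z + psi Y
         <= infimum_char Y + psi X + psi Z)%N].
Proof.
move=> fc; rewrite /infimum_char (infimum_nullity fc).
have := infimum_le_source f; have := infimum_step (idm X) f.
rewrite comp_idr !rank_idm //; have := rank_coker Cab chiC fc.
have := rank_coker Cab psiC fc.
have := char_exact chiC fc; have := char_exact psiC fc.
by split; lia.
Qed.

(** A filtration of cost 0 of a subfunctor on which chi or psi does not vanish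
    has a smallest term of this kind, and there just one of them vanishes. *)
Lemma filtration0_separates (X W : C) (a : hom X W) n :
  filtration a n -> n = 0%N -> (0 < rchi a + rpsi a)%N ->
  exists V (b : hom X V),
    (rchi b = 0 /\ rpsi b <> 0)%N \/ (rchi b <> 0 /\ rpsi b = 0)%N.
Proof.
elim=> {W a n} [W|W W' a g n _ IH] n0; first by rewrite !rank0.
have [|rg] := posnP (rchi (g \oc a) + rpsi (g \oc a)); last first.
  by move=> _; apply: IH rg; lia.
by move=> rg ra; exists W, a; lia.
Qed.

End Infimum.

Section Irreducible.
Variables (k : comPzRingType) (C : lincat k).

Lemma sub_character (chi mu : C -> nat) :
  character chi ->
  (forall X, mu X <= chi X)%N ->
  (forall X Y Z (f : hom X Y) (c : hom Y Z), is_cokernel f c ->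
    (mu Y <= mu X + mu Z)%N /\
    (mu X + mu Z + chi Y <= mu Y + chi X + chi Z)%N) ->
  character mu /\ character (fun X => chi X - mu X)%N.
Proof.
move=> chiC le_mu mu_ex.
have mu_sum X Y S : direct_sum X Y S -> mu S = (mu X + mu Y)%N.
  move=> XYS; have [iX [iY [pX [pY [_ eY _ eYX eS]]]]] := XYS.
  have c := direct_sum_coker eY eYX eS.
  by have [] := mu_ex _ _ _ _ _ c; have := char_sum chiC XYS; lia.
split; split.
- exact: mu_sum.
- by move=> X Y Z f c /mu_ex [].
- move=> X Y S XYS; rewrite (mu_sum _ _ _ XYS) (char_sum chiC XYS).
  by have := le_mu X; have := le_mu Y; lia.
- move=> X Y Z f c fc; have [] := mu_ex _ _ _ _ _ fc.
  have := char_exact chiC fc.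
  by have := le_mu X; have := le_mu Y; have := le_mu Z; lia.
Qed.

Lemma irreducible_sub (chi mu : C -> nat) :
  irreducible chi -> (forall X, mu X <= chi X)%N ->
  (forall X Y Z (f : hom X Y) (c : hom Y Z), is_cokernel f c ->
    (mu Y <= mu X + mu Z)%N /\
    (mu X + mu Z + chi Y <= mu Y + chi X + chi Z)%N) ->
  mu = @zero_char _ C \/ mu = chi.
Proof.
move=> [chiC _ chiI] le_mu mu_ex.
have [muC nuC] := sub_character chiC le_mu mu_ex.
have [->|mu0] := pselect (mu = @zero_char _ C); first by left.
right; apply: contrapT => mu_chi; apply: chiI.
exists mu, (fun X => chi X - mu X)%N; split=> //.
  move=> nu0; apply: mu_chi; apply: funext => X.
  have := congr1 (fun h => h X) nu0; have := le_mu X.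
  by rewrite /zero_char; lia.
by apply: funext => X; have := le_mu X; lia.
Qed.

Lemma char_neq0 (chi : C -> nat) :
  chi <> @zero_char _ C -> exists X, (0 < chi X)%N.
Proof.
move=> chi0; apply: contrapT => no; apply: chi0; apply: funext => X.
by apply/eqP; rewrite -leqn0 leqNgt; apply/negP => chiX; apply: no; exists X.
Qed.

(** The infimum of two different irreducible characters is a summand of both,
    hence zero, so some filtration of Hom(X, -) has cost 0. *)
Lemma irreducible_separated (chi psi : C -> nat) :
  abelian C -> irreducible chi -> irreducible psi -> chi <> psi ->
  exists (W Q : C) (q : hom W Q), epi q /\
    ((chi W = chi Q /\ psi W <> psi Q) \/ (chi W <> chi Q /\ psi W = psi Q)).
Proof.
move=> Cab chiI psiI neq.
have [[chiC chi0 _] [psiC _ _]] := (chiI, psiI).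
have inf0 : infimum_char Cab chi psi = @zero_char _ C.
  have [//|e1] := irreducible_sub chiI
    (fun X => (infimum_char_le Cab chiC psiC X).1)
    (fun X Y Z f c fc => let: And3 h1 h2 h3 :=
       infimum_char_exact Cab chiC psiC fc in conj h1 h2).
  have [//|e2] := irreducible_sub psiI
    (fun X => (infimum_char_le Cab chiC psiC X).2)
    (fun X Y Z f c fc => let: And3 h1 h2 h3 :=
       infimum_char_exact Cab chiC psiC fc in conj h1 h3).
  by case: neq; apply: etrans (esym e1) e2.
have [X chiX] := char_neq0 chi0.
have [|V [b sep]] := filtration0_separates chiC psiC
  (infimum_filtration Cab chi psi (idm X)) (congr1 (fun h => h X) inf0).
  by rewrite rank_idm //; lia.
have [Q [q bq]] := ab_coker Cab b; exists V, Q, q.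
split; first exact: coker_epi bq.
by have := rank_coker Cab chiC bq; have := rank_coker Cab psiC bq; lia.
Qed.

End Irreducible.

(** * Quotients in an abelian length category *)

Section Abelian.
Variables (k : comPzRingType) (C : lincat k).
Hypothesis Cab : abelian C.

Lemma mono_kernel (X Y Z : C) (f : hom X Y) (q : hom Y Z) :
  mono f -> is_cokernel f q -> is_kernel f q.
Proof.
move=> fm fq; have [Z' [g fg]] := ab_mono Cab fm.
have [h hq] := coker_factor fq fg.1.
split=> [|W a qa]; first exact: fq.1.
have [|b fb] := ker_factor (h := a) fg.
  by rewrite -hq -comp_assoc qa comp0r.
by exists b; split=> // b' fb'; apply: fm; rewrite fb.
Qed.

Lemma mono_epi_iso (X Y : C) (f : hom X Y) : mono f -> epi f -> iso f.
Proof.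
move=> fm fe; have [Z [g fg]] := ab_mono Cab fm.
have g0 : g = 0 by apply: (epi_eq0 fe fg.1).
have [|h fh] := ker_factor (h := idm Y) fg; first by rewrite g0 comp0l.
by exists h; split=> //; apply: fm; rewrite comp_assoc fh comp_idl comp_idr.
Qed.

Lemma image_ex (X Y : C) (f : hom X Y) :
  exists I (e : hom X I) (m : hom I Y), [/\ epi e, mono m & m \oc e = f].
Proof.
have [Q [q fq]] := ab_coker Cab f.
have [I [m mq]] := ab_ker Cab q.
have mm := ker_mono mq.
have [e me] := ker_factor mq fq.1.
exists I, e, m; split=> //.
(* If e factored through a proper subobject J of I, then J, being a kernel,
   would be cut out by a map that kills f, hence kills I. *)
have [R [c ec]] := ab_coker Cab e; have [J [n nc]] := ab_ker Cab c.
have [e' ne'] := ker_factor nc ec.1.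
have [D [d mnd]] := ab_mono Cab (mono_comp mm (ker_mono nc)).
have [|d' d'q] := coker_factor (h := d) fq.
  by rewrite -me -ne' !comp_assoc -(comp_assoc d) mnd.1 comp0l.
have [|t mnt] := ker_factor (h := m) mnd.
  by rewrite -d'q -comp_assoc mq.1 comp0r.
have nt : n \oc t = idm I by apply: mm; rewrite comp_assoc mnt comp_idr.
have c0 : c = 0 by rewrite -(comp_idr c) -nt comp_assoc nc.1 comp0l.
by apply: epi_coker0 => W g /(coker_factor ec) [g' <-]; rewrite c0 comp0r.
Qed.

Lemma epi_factor (X Y Z : C) (q : hom X Y) (f : hom X Z) :
  epi q -> (forall W (g : hom W X), q \oc g = 0 -> f \oc g = 0) ->
  exists f', f' \oc q = f.
Proof.
move=> qe kf; have [X' [g gq]] := ab_epi Cab qe.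
by apply: (coker_factor gq); apply: kf; apply: gq.1.
Qed.

Definition proper_quotient (Z X : C) : Prop :=
  exists q : hom X Z, epi q /\ ~ mono q.

Lemma Acc_epi_mono (X Y : C) (f : hom X Y) :
  mono f -> epi f -> Acc proper_quotient X -> Acc proper_quotient Y.
Proof.
move=> fm fe [X_Acc]; constructor=> Z [q [qe qm]]; apply: X_Acc.
exists (q \oc f); split; first exact: epi_comp.
move=> qfm; apply: qm; have [g [_ fg]] := mono_epi_iso fm fe.
apply: mono_ker0 => W h qh; rewrite -(comp_idl h) -fg -comp_assoc.
rewrite (mono_eq0 (g := g \oc h) qfm) ?comp0r //.
by rewrite comp_assoc -(comp_assoc q) fg comp_idr.
Qed.

Lemma Acc_epi (X Y : C) (f : hom X Y) :
  epi f -> Acc proper_quotient X -> Acc proper_quotient Y.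
Proof.
have [fm fe|fm fe [X_Acc]] := pselect (mono f); first exact: Acc_epi_mono fm fe.
by apply: X_Acc; exists f.
Qed.

Lemma simple_epi (S T : C) (q : hom S T) :
  simple S -> epi q -> mono q \/ zero_object T.
Proof.
move=> [_ Ssimple] qe; have [K [n nq]] := ab_ker Cab q.
have [K0|[g [_ ng]]] := Ssimple _ _ (ker_mono nq).
  left; apply: mono_ker0 => W g /(ker_factor nq) [g' <-].
  by rewrite (K0.1 _ g') comp0r.
right; apply: zero_object_idm; apply: (epi_eq0 qe); rewrite comp_idl.
by rewrite -(comp_idr q) -ng comp_assoc nq.1 comp0l.
Qed.

(** A proper quotient of an extension of S by U is a quotient of U or an
    extension of S by a proper quotient of U. *)
Lemma Acc_extension (U : C) :
  Acc proper_quotient U ->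
  forall (X S : C) (f : hom U X) (g : hom X S),
    is_kernel f g -> is_cokernel f g -> simple S -> Acc proper_quotient X.
Proof.
elim=> {}U U_Acc IH X S f g fker fcok Ss; constructor=> Z [q [qe qm]].
have AccU : Acc proper_quotient U by constructor.
have [T [h qfh]] := ab_coker Cab (q \oc f).
have [|s sg] := coker_factor (h := h \oc q) fcok.
  by rewrite -comp_assoc qfh.1.
have se : epi s.
  apply: (@epi_cancel _ _ _ _ _ s g); rewrite sg.
  by apply: epi_comp qe; apply: coker_epi qfh.
have [sm|T0] := simple_epi Ss se; last first.
  apply: (Acc_epi (f := q \oc f)) AccU; apply: epi_coker0 => W a aqf.
  by have [b <-] := coker_factor qfh aqf; rewrite (T0.2 _ b) comp0l.
have [r [rs sr]] := mono_epi_iso sm se.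
have [I [e [m [ee mm me]]]] := image_ex (q \oc f).
have [em|em] := pselect (mono e).
  case: qm; apply: mono_ker0 => W a qa.
  have [|b fb] := ker_factor (h := a) fker.
    by apply: (mono_eq0 sm); rewrite comp_assoc sg -comp_assoc qa comp0r.
  rewrite -fb (mono_eq0 (g := b) em) ?comp0r //.
  by apply: (mono_eq0 mm); rewrite comp_assoc me -comp_assoc fb.
have hm : is_cokernel m h.
  apply: is_cokernel_intro; last 2 first.
  - exact: coker_epi qfh.
  - move=> W a am; apply: (coker_factor qfh).
    by rewrite -me comp_assoc am comp0l.
  by apply: (epi_eq0 ee); rewrite -comp_assoc me qfh.1.
have T_simple : simple T.
  case: Ss => S0 Ss; split.
    move=> T0; apply: S0; apply: zero_object_idm.
    by rewrite -rs (T0.1 _ s) comp0r.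
  move=> V n nm; have rm : mono r.
    by apply: (@mono_cancel _ _ _ _ _ s r); rewrite sr; apply: idm_mono.
  have [|[n' [n'n nn']]] := Ss _ _ (mono_comp rm nm); first by left.
  right; exists (n' \oc r); split; first by rewrite -comp_assoc.
  rewrite comp_assoc -(comp_idl n) -sr -!comp_assoc (comp_assoc r).
  by rewrite (comp_assoc _ n') nn' comp_idl.
by apply: (IH I _ _ _ m h _ hm T_simple); [exists e|exact: mono_kernel mm hm].
Qed.

Lemma proper_quotient_wf (X : C) : finite_length X -> Acc proper_quotient X.
Proof.
elim=> {X} [X X0|U X S f g _ AccU fker fcok Ss]; last first.
  exact: Acc_extension AccU _ _ _ _ fker fcok Ss.
constructor=> Z [q [_ []]]; apply: mono_ker0 => W g _; exact: X0.1.
Qed.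

End Abelian.

(** * Reflective subcategories and characters *)

Section Reflection.
Variables (k : comPzRingType) (C : lincat k) (D : set C).
Hypotheses (Cab : abelian C) (Dsoc : subobject_closed D).

Definition universal_arrow (X : C) (P : full_subcat D) (r : hom X (sval P)) :=
  forall (Y : full_subcat D) (f : hom X (sval Y)),
    exists! g : hom (sval P) (sval Y), g \oc r = f.

Lemma universal_factor (X : C) (P : full_subcat D) (r : hom X (sval P)) :
  universal_arrow r -> forall (Y : C) (f : hom X Y), D Y ->
  exists g, g \oc r = f.
Proof.
move=> r_univ Y f DY; have [g [gr _]] := r_univ (exist _ Y DY) f.
by exists g.
Qed.

Lemma universal_unique (X : C) (P : full_subcat D) (r : hom X (sval P)) :
  universal_arrow r -> forall (Y : C) (g h : hom (sval P) Y), D Y ->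
  g \oc r = h \oc r -> g = h.
Proof.
move=> r_univ Y g h DY e; have [g' [_ U]] := r_univ (exist _ Y DY) (h \oc r).
by rewrite -(U g) // -(U h).
Qed.

(** The image of r lies in D, so r factors through it and, conversely, the
    image map factors through r. *)
Lemma universal_epi (X : C) (P : full_subcat D) (r : hom X (sval P)) :
  universal_arrow r -> epi r.
Proof.
move=> r_univ; have [I [e [m [ee mm me]]]] := image_ex Cab r.
have DI : D I by apply: (soc_sub Dsoc mm); apply: svalP.
have [g gr] := universal_factor r_univ e DI.
have mg : m \oc g = idm (sval P).
  apply: (universal_unique r_univ (svalP P)).
  by rewrite -comp_assoc gr me comp_idl.
rewrite -me; apply: epi_comp ee; apply: (@epi_cancel _ _ _ _ _ m g).
by rewrite mg; apply: idm_epi.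
Qed.

Lemma full_subcat_zero : exists Z : full_subcat D, zero_object Z.
Proof.
have [Z Z0 DZ] := soc_zero Dsoc; exists (exist _ Z DZ).
by split=> X f; apply Z0.
Qed.

Variable p : C -> full_subcat D.
Hypothesis p_adj : left_adjoint p.

Definition unit_arrow (X : C) : hom X (sval (p X)) := projT1 (cid (p_adj X)).

Lemma unit_universal X : universal_arrow (unit_arrow X).
Proof. by rewrite /unit_arrow; case: cid. Qed.

Lemma reflection_ex (X Y : C) (f : hom X Y) :
  exists g : hom (sval (p X)) (sval (p Y)),
    g \oc unit_arrow X = unit_arrow Y \oc f.
Proof. exact: (universal_factor (@unit_universal X) _ (svalP (p Y))). Qed.

Lemma reflection_iso (Y : full_subcat D) :
  exists f : hom Y (p (sval Y)), iso f.
Proof.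
have univ := @unit_universal (sval Y).
have [g gr] := universal_factor univ (idm (sval Y)) (svalP Y).
exists (unit_arrow (sval Y)), g; split=> //.
apply: (universal_unique univ (svalP _)).
by rewrite -comp_assoc gr comp_idl comp_idr.
Qed.

(** A left adjoint preserves direct sums and cokernels. *)
Lemma reflection_char (phi : full_subcat D -> nat) :
  character phi -> character (phi \o p).
Proof.
move=> phiC; have ext X := universal_unique (@unit_universal X).
split=> [X Y S [iX [iY [pX [pY [eX eY eXY eYX eS]]]]]|X Y Z f g fg] /=.
  apply: (char_sum phiC).
  have [jX jXE] := reflection_ex iX; have [jY jYE] := reflection_ex iY.
  have [qX qXE] := reflection_ex pX; have [qY qYE] := reflection_ex pY.
  exists jX, jY, qX, qY.
  have DP A := svalP (p A).
  split; apply: (ext _ _ _ _ (DP _)) => /=.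
  - by rewrite -comp_assoc jXE comp_assoc qXE -comp_assoc eX comp_idl comp_idr.
  - by rewrite -comp_assoc jYE comp_assoc qYE -comp_assoc eY comp_idl comp_idr.
  - by rewrite -comp_assoc jYE comp_assoc qXE -comp_assoc eXY comp0l comp0r.
  - by rewrite -comp_assoc jXE comp_assoc qYE -comp_assoc eYX comp0l comp0r.
  rewrite compDl -!comp_assoc qXE qYE !comp_assoc jXE jYE -!comp_assoc.
  by rewrite -compDr eS comp_idl comp_idr.
have [f' f'E] := reflection_ex f; have [g' g'E] := reflection_ex g.
apply: (char_exact phiC (f := f') (g := g')).
suff fgp : g' \oc f' = 0 /\ forall (W : full_subcat D)
    (h : hom (sval (p Y)) (sval W)), h \oc f' = 0 ->
    exists! h' : hom (sval (p Z)) (sval W), h' \oc g' = h by [].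
split=> [|W h hf'].
  apply: (ext _ _ _ _ (svalP _)).
  by rewrite -comp_assoc f'E comp_assoc g'E -comp_assoc fg.1 comp0l comp0r.
have [|h1 h1g] := coker_factor (h := h \oc unit_arrow Y) fg.
  by rewrite -comp_assoc -f'E comp_assoc hf' comp0l.
have [h2 h2u] := universal_factor (@unit_universal Z) h1 (svalP W).
exists h2; split.
  apply: (ext _ _ _ _ (svalP W)).
  by rewrite /= -comp_assoc g'E comp_assoc h2u.
move=> h3 /= h3g; apply: (ext _ _ _ _ (svalP W)); rewrite h2u.
apply: (coker_epi fg); rewrite h1g -h3g -!comp_assoc g'E.
by [].
Qed.

(** Composing with p turns a decomposition of the restriction of chi to D into
    one of chi. *)
Lemma Sp_of_intro (chi : Sp C) :
  (forall X, sval chi X = sval chi (sval (p X))) -> Sp_of D chi.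
Proof.
case: chi => chi chiI /= chip; have [chiC chi0 chi_irr] := chiI.
suff phiI : irreducible (fun Y : full_subcat D => chi (sval Y)).
  exists p, (exist _ _ phiI); split=> //=.
  by apply: funext => X /=.
split.
- split=> [X Y S XYS|X Y Z f g fg].
    by apply: (char_sum chiC).
  have [Q [q fq]] := ab_coker Cab (f : hom (sval X) (sval Y)).
  apply: leq_trans (char_exact chiC fq) _; rewrite leq_add2l chip.
  have [|t tg] := coker_factor (h := unit_arrow Q \oc q : hom Y (p Q)) fg.
    by rewrite -[LHS]comp_assoc fq.1 comp0r.
  have {}tg : (t : hom (sval Z) (sval (p Q))) \oc (g : hom (sval Y) (sval Z))
      = unit_arrow Q \oc q := tg.
  apply: (char_epi chiC (ab_zero Cab) (q := t)).
  apply: (epi_cancel (f := (g : hom (sval Y) (sval Z)))); rewrite tg.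
  by apply: epi_comp (coker_epi fq); apply/universal_epi/unit_universal.
- have [X chiX] := char_neq0 chi0.
  move=> /(congr1 (fun h => h (p X))); rewrite -chip /zero_char.
  by lia.
- move=> [phi [psi [phiC psiC phi0 psi0 e]]]; apply: chi_irr.
  exists (phi \o p), (psi \o p); split; try exact: reflection_char.
  + move=> e0; apply: phi0; apply: funext => Y.
    have [f fi] := reflection_iso Y.
    rewrite (char_iso phiC full_subcat_zero fi).
    exact: (congr1 (fun h => h (sval Y)) e0).
  + move=> e0; apply: psi0; apply: funext => Y.
    have [f fi] := reflection_iso Y.
    rewrite (char_iso psiC full_subcat_zero fi).
    exact: (congr1 (fun h => h (sval Y)) e0).
  + by apply: funext => X; rewrite chip; apply: (congr1 (fun h => h (p X)) e).
Qed.

End Reflection.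

Lemma Sp_of_reflection (k : comPzRingType) (C : lincat k) (D : set C)
    (chi : Sp C) :
  subobject_closed D -> Sp_of D chi -> exists2 p : C -> full_subcat D,
    left_adjoint p & forall X, sval chi X = sval chi (sval (p X)).
Proof.
move=> Dsoc [p [[phi [phiC _ _]] [p_adj /= chip]]]; exists p => // X.
rewrite chip /=; have [f fi] := reflection_iso p_adj (p X).
by rewrite (char_iso phiC (full_subcat_zero Dsoc) fi).
Qed.

(** * The smallest subobject-closed subcategory supporting a character *)

Section Reduced.
Variables (k : comPzRingType) (C : lincat k).
Hypothesis Cab : abelian C.

(** For chi = chi_M these are the objects cogenerated by M. *)
Definition reduced (chi : C -> nat) : set C :=
  [set X | forall Z (q : hom X Z), epi q -> chi Z = chi X -> mono q].

Section Reflect.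
Variable chi : C -> nat.
Hypothesis chiC : character chi.

(** Push q out along f: by right exactness the pushout is a quotient of X with
    the same value of chi, hence equal to X. *)
Lemma reduced_factor (X Y Z : C) (q : hom Y Z) (f : hom Y X) :
  epi q -> chi Z = chi Y -> reduced chi X -> exists f', f' \oc q = f.
Proof.
move=> qe qchi Xred; have [P [u [w po]]] := pushout_ex Cab q f.
have [sq _ un] := po.
have we : epi w.
  move=> W h h' e; apply: un => //; apply: qe.
  by rewrite -!comp_assoc sq !comp_assoc e.
have wm : mono w.
  apply: Xred => //; apply/eqP.
  rewrite eqn_leq (char_epi chiC (ab_zero Cab) we).
  by have := char_pushout Cab chiC po; rewrite qchi leq_add2l.
apply: epi_factor => // W g qg; apply: (mono_eq0 wm).
by rewrite comp_assoc -sq -comp_assoc qg comp0r.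
Qed.

Lemma reduced_closed : subobject_closed (reduced chi).
Proof.
split.
- have [Z Z0] := ab_zero Cab; exists Z => // W q _ _.
  by apply: mono_ker0 => V g _; apply: Z0.1.
- move=> X Y S Xred Yred [iX [iY [pX [pY [_ _ _ _ eS]]]]] Z q qe qchi.
  have [f fq] := reduced_factor pX qe qchi Xred.
  have [g gq] := reduced_factor pY qe qchi Yred.
  apply: mono_ker0 => W h qh; rewrite -(comp_idl h) -eS compDl -!comp_assoc.
  by rewrite -fq -gq -!comp_assoc qh !comp0r addr0.
- move=> U X f fm Xred Z q qe qchi.
  have [g gq] := reduced_factor f qe qchi Xred.
  by apply: (@mono_cancel _ _ _ _ _ g); rewrite gq.
Qed.

Hypothesis Clength : length_category C.

Lemma reduced_quotient_ex (X : C) :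
  exists Z (q : hom X Z), [/\ epi q, chi Z = chi X & reduced chi Z].
Proof.
elim: (proper_quotient_wf Cab (Clength X)) => {}X _ IH.
have [Xred|Xnred] := pselect (reduced chi X).
  by exists X, (idm X); split=> //; apply: idm_epi.
have [Z [q [qe qchi qm]]] :
    exists Z (q : hom X Z), [/\ epi q, chi Z = chi X & ~ mono q].
  apply: contrapT => no; apply: Xnred => Z q qe qchi.
  by apply: contrapT => qm; apply: no; exists Z, q.
have [|V [r [re rchi Vred]]] := IH Z; first by exists q.
exists V, (r \oc q); split=> //; first exact: epi_comp.
by rewrite rchi.
Qed.

Lemma reduced_reflection : exists2 p : C -> full_subcat (reduced chi),
  left_adjoint p & forall X, chi X = chi (sval (p X)).
Proof.
have H (X : C) : exists P : full_subcat (reduced chi),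
    (exists r : hom X (sval P), universal_arrow r) /\ chi X = chi (sval P).
  have [Z [q [qe qchi Zred]]] := reduced_quotient_ex X.
  exists (exist _ Z Zred); split=> //; exists q => Y f.
  have [g gq] := reduced_factor f qe qchi (svalP Y).
  by exists g; split=> // h hq; apply: qe; rewrite hq.
have [p pE] := choice H.
by exists p => X; have [[r r_univ] e] := pE X; first by exists r.
Qed.

End Reflect.

Hypothesis Clength : length_category C.

Lemma Sp_of_reduced (chi : Sp C) : Sp_of (reduced (sval chi)) chi.
Proof.
have [chiC _ _] := svalP chi.
have [p p_adj chip] := reduced_reflection chiC Clength.
exact: (Sp_of_intro Cab (reduced_closed chiC) p_adj chip).
Qed.

Lemma reduced_sub (chi : Sp C) (D : set C) :
  subobject_closed D -> Sp_of D chi -> reduced (sval chi) `<=` D.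
Proof.
move=> Dsoc /(Sp_of_reflection Dsoc) [p p_adj chip] X Xred.
have r_univ := @unit_universal _ _ _ p p_adj X.
apply: (soc_sub Dsoc (f := unit_arrow p_adj X)) (svalP (p X)).
by apply: Xred (universal_epi Cab Dsoc r_univ) _; rewrite -chip.
Qed.

(** A quotient W -> Q which chi cannot distinguish induces one of the
    psi-reduction of W, provided that is chi-reduced too. *)
Lemma reduced_eq_value (chi psi : C -> nat) (W Q : C) (q : hom W Q) :
  character chi -> character psi -> reduced psi `<=` reduced chi ->
  epi q -> chi W = chi Q -> psi W = psi Q.
Proof.
move=> chiC psiC sub_red qe qchi.
have [V [s [se spsi Vred]]] := reduced_quotient_ex psi Clength W.
have [t tq] := reduced_factor chiC s qe (esym qchi) (sub_red _ Vred).
have te : epi t by apply: (@epi_cancel _ _ _ _ _ t q); rewrite tq.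
have := char_epi psiC (ab_zero Cab) te; rewrite spsi.
by have := char_epi psiC (ab_zero Cab) qe; lia.
Qed.

(** If chi and psi differ, a quotient map distinguishes them by an equality of
    values for one of them only, against the preceding lemma. *)
Lemma reduced_inj (chi psi : Sp C) :
  reduced (sval chi) = reduced (sval psi) -> chi = psi.
Proof.
move=> e; apply: contrapT => neq.
have [[chiC _ _] [psiC _ _]] := (svalP chi, svalP psi).
have neq' : sval chi <> sval psi.
  move=> e'; apply: neq; move: e'; clear.
  by case: chi psi => [chi chiI] [psi psiI]; apply: eq_exist.
have [W [Q [q [qe [[e1 e2]|[e1 e2]]]]]] :=
  irreducible_separated Cab (svalP chi) (svalP psi) neq'.
- by apply: e2; apply: (reduced_eq_value chiC psiC _ qe e1); rewrite e.
- by apply: e1; apply: (reduced_eq_value psiC chiC _ qe e2); rewrite e.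
Qed.

End Reduced.

(** * Lengths of modules *)

Section Length.
Variables (R : pzRingType) (V : lmodType R).
Implicit Types S T : {pred V}.

Definition chain_to T (n : nat) : Prop :=
  exists2 S, submodule_chain (V := V) S n & S n =i T.

Lemma submod_eq S T : S =i T -> submod_closed S -> submod_closed T.
Proof.
by move=> e [S0 Sl]; split=> [|a u v]; rewrite -!e //; apply: Sl.
Qed.

Lemma chain_to_submod T n : chain_to T n -> submod_closed T.
Proof. by case=> S [Ssub _] /submod_eq; apply; apply: Ssub. Qed.

Lemma chain_to0 T : submod_closed T -> chain_to T 0.
Proof. by move=> Tsub; exists (fun=> T). Qed.

Lemma chain_to_eq S T n : S =i T -> chain_to S n -> chain_to T n.
Proof. by move=> e [U Uchain Un]; exists U => // v; rewrite Un e. Qed.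

Lemma chain_to_extend S T n :
  chain_to S n -> submod_closed T -> {subset S <= T} -> ~ {subset T <= S} ->
  chain_to T n.+1.
Proof.
move=> [U [Usub Ustrict] Un] Tsub ST TS.
exists (fun i => if (i <= n)%N then U i else T); last by move=> v; rewrite ltnn.
split=> i; first by case: ifP => // i_n _; apply: Usub.
move=> i_n1; have /predU1P[->|i_n] : (i == n) || (i < n)%N by lia.
  rewrite leqnn ltnn; split=> [v|sub]; first by rewrite Un => /ST.
  by apply: TS => v /sub; rewrite Un.
by rewrite (ltnW i_n) i_n; apply: Ustrict.
Qed.

Lemma chain_to_ind T n : chain_to T n.+1 ->
  exists S, [/\ chain_to S n, {subset S <= T} & ~ {subset T <= S}].
Proof.
move=> [U [Usub Ustrict] Un]; exists (U n); split.
- exists U => //; split=> i i_n; first by apply: Usub; lia.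
  by apply: Ustrict; lia.
- by move=> v /(Ustrict n (leqnn _)).1; rewrite Un.
- move=> sub; apply: (Ustrict n (leqnn _)).2 => v; rewrite Un; exact: sub.
Qed.

Definition chain_in T (n : nat) : Prop :=
  exists2 S, chain_to S n & {subset S <= T}.

Lemma chain_in_sub S T n : {subset S <= T} -> chain_in S n -> chain_in T n.
Proof. by move=> ST [U Un US]; exists U => // v /US /ST. Qed.

Lemma chain_in_lt S T n : chain_in S n -> submod_closed T ->
  {subset S <= T} -> ~ {subset T <= S} -> chain_in T n.+1.
Proof.
move=> [U Un US] Tsub ST TS; exists T => //.
apply: chain_to_extend Un Tsub _ _ => [v /US /ST //|sub].
by apply: TS => v /sub /US.
Qed.

Lemma has_lengthP n : has_length V n <->
  chain_in predT n /\ (forall m, chain_in predT m -> (m <= n)%N).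
Proof.
split=> [[[S Schain] Sn]|[[T [S Schain _] _] Tn]]; split.
- by exists (S n) => //; exists S.
- by move=> m [T [U Uchain _] _]; apply: Sn Uchain.
- by exists S.
- by move=> U m Uchain; apply: Tn; exists (U m) => //; exists U.
Qed.

Lemma has_length_unique n m : has_length V n -> has_length V m -> n = m.
Proof.
move=> [[S Sn] Vn] [[T Tm] Vm]; apply/eqP; rewrite eqn_leq.
by rewrite (Vm _ _ Sn) (Vn _ _ Tm).
Qed.

Lemma lengthE n : has_length V n -> length V = n.
Proof.
move=> Vn; rewrite /length; case: xgetP => [m _ Vm|/(_ n)//].
exact: has_length_unique Vm Vn.
Qed.

Lemma has_length_bounded N :
  (forall (U : nat -> {pred V}) m,
    submodule_chain (V := V) U m -> (m <= N)%N) ->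
  has_length V (length V).
Proof.
move=> bound.
have exP : exists n, `[< exists U, submodule_chain (V := V) U n >].
  exists 0%N; apply/asboolP; by exists (fun=> (predT : {pred V})).
have ubP n : `[< exists U, submodule_chain (V := V) U n >] -> (n <= N)%N.
  by move=> /asboolP[S /bound].
case: (ex_maxnP exP ubP) => n /asboolP Sn n_max.
suff Vn : has_length V n by rewrite (lengthE Vn).
by split=> // U m Um; apply: n_max; apply/asboolP; exists U.
Qed.

(** Otherwise the first terms, read backwards, would form chains of any
    length. *)
Lemma descending_stop n (S : nat -> {pred V}) :
  has_length V n -> (forall i, submod_closed (S i)) ->
  (forall i, {subset S i.+1 <= S i}) -> exists i, {subset S i <= S i.+1}.
Proof.
move=> /has_lengthP [_ Vn] Ssub Sdec; apply: contrapT => no.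
have chainS m i : chain_to (S i) m.
  elim: m i => [|m IH] i; first exact: chain_to0.
  by apply: chain_to_extend (IH i.+1) _ _ _ => // sub; apply: no; exists i.
have : (n.+1 <= n)%N by apply: Vn; exists (S 0%N).
by rewrite ltnn.
Qed.

(** The easy half of Fitting's lemma: the images of the powers of an
    endomorphism become stationary. *)
Lemma iter_image_stable n (f : {linear V -> V}) : has_length V n ->
  exists m, forall N, (m <= N)%N ->
    forall v, exists u, iter N f v = iter (N + N) f u.
Proof.
move=> Vn; pose S i : {pred V} := [pred w | `[< exists v, iter i f v = w >]].
have iter_lin i a u v : iter i f (a *: u + v) = a *: iter i f u + iter i f v.
  by elim: i => //= i ->; rewrite linearP.
have [i|i w /asboolP[v <-]|m sub] := descending_stop (S := S) Vn.
- split=> [|a _ _ /asboolP[u <-] /asboolP[v <-]]; apply/asboolP.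
    by exists 0; elim: i => //= i ->; rewrite linear0.
  by exists (a *: u + v).
- by apply/asboolP; exists (f v); rewrite -iterSr.
exists m => N mN.
suff stable d v : exists u, iter N f v = iter (N + d) f u.
  by move=> v; apply: stable.
elim: d v => [|d IH] v; first by exists v; rewrite addn0.
have /asboolP[u e] : iter m f v \in S m.+1.
  by apply: sub; apply/asboolP; exists v.
have [u' e'] := IH u; exists u'; rewrite addnS iterS -e'.
by rewrite -(subnK mN) !iterD -e iterS -!iterS -iterSr.
Qed.

End Length.

Section LengthNullity.
Variables (R : pzRingType) (U V W : lmodType R).
Variables (i : {linear U -> V}) (f : {linear V -> W}).

Definition image_pred (S : {pred V}) : {pred W} :=
  [pred w | `[< exists2 v, v \in S & f v = w >]].

Definition preim_pred (S : {pred W}) : {pred V} := [pred v | f v \in S].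

Lemma image_submod S : submod_closed S -> submod_closed (image_pred S).
Proof.
move=> [S0 Sl]; split=> [|a _ _ /asboolP[u uS <-] /asboolP[v vS <-]].
  by apply/asboolP; exists 0 => //; rewrite linear0.
by apply/asboolP; exists (a *: u + v); [apply: Sl|rewrite linearP].
Qed.

Lemma preim_submod S : submod_closed S -> submod_closed (preim_pred S).
Proof.
move=> [S0 Sl]; split=> [|a u v]; first by rewrite inE linear0.
by rewrite !inE linearP; apply: Sl.
Qed.

End LengthNullity.

Section LengthExact.
Variables (R : pzRingType) (U V W : lmodType R).
Variables (i : {linear U -> V}) (f : {linear V -> W}).

(** A chain of V restricts to U and projects to the image of f, and each
    strict inclusion stays strict on at least one side. *)
Lemma chain_split b n :
  (forall v, f v = 0 -> exists u, i u = v) -> has_length U b ->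
  chain_in (V := V) predT n ->
  exists2 c, (n <= b + c)%N & chain_in (image_pred f predT) c.
Proof.
move=> kf /has_lengthP [_ Ub] [T Tn _].
suff : exists b' c, [/\ (n <= b' + c)%N, chain_to (preim_pred i T) b'
    & chain_to (image_pred f T) c].
  move=> [b' [c [n_le Tb' Tc]]]; exists c.
    have b'_le : (b' <= b)%N by apply: Ub; exists (preim_pred i T).
    by lia.
  by exists (image_pred f T) => // w /asboolP[v _ fv]; apply/asboolP; exists v.
elim: n T Tn => [|n IH] T Tn.
  have Tsub := chain_to_submod Tn.
  exists 0%N, 0%N; split=> //; apply: chain_to0; first exact: preim_submod.
  exact: image_submod.
have Tsub := chain_to_submod Tn.
have [S [Sn ST TS]] := chain_to_ind Tn.
have Ssub := chain_to_submod Sn.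
have [b' [c [n_le Sb' Sc]]] := IH S Sn.
have iST : {subset preim_pred i S <= preim_pred i T} by move=> u; apply: ST.
have fST : {subset image_pred f S <= image_pred f T}.
  by move=> w /asboolP[v /ST vT fv]; apply/asboolP; exists v.
have [iTS|iTS] := pselect {subset preim_pred i T <= preim_pred i S}; last first.
  have [fTS|fTS] :=
      pselect {subset image_pred f T <= image_pred f S}; last first.
    exists b'.+1, c.+1; split; [lia| |].
      exact: chain_to_extend Sb' (preim_submod _ Tsub) iST iTS.
    exact: chain_to_extend Sc (image_submod _ Tsub) fST fTS.
  exists b'.+1, c; split; [lia| |].
    exact: chain_to_extend Sb' (preim_submod _ Tsub) iST iTS.
  by apply: chain_to_eq Sc => w; apply/idP/idP; [apply: fST|apply: fTS].
exists b', c.+1; split; [lia| |].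
  by apply: chain_to_eq Sb' => u; apply/idP/idP; [apply: iST|apply: iTS].
apply: chain_to_extend Sc (image_submod _ Tsub) fST _ => fTS.
apply: TS => v vT; have /asboolP[v' v'S fv'] : f v \in image_pred f S.
  by apply: fTS; apply/asboolP; exists v.
have [|u iu] := kf (v - v'); first by rewrite linearB fv' subrr.
rewrite -(subrK v' v) -iu; have : u \in preim_pred i S.
  apply: iTS; rewrite inE iu; case: Tsub => _ Tl.
  by rewrite addrC -scaleN1r; apply: Tl => //; apply: ST.
rewrite inE => iuS; case: Ssub => _ Sl.
by rewrite -(scale1r (i u)); apply: Sl.
Qed.

(** A chain of U followed by the preimage of a chain of the image of f. *)
Lemma chain_join b c :
  injective i -> (forall u, f (i u) = 0) ->
  chain_in (V := U) predT b -> chain_in (image_pred f predT) c ->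
  chain_in (V := V) predT (b + c).
Proof.
move=> i_inj fi0 [S Sb _] [T Tc Tim].
suff [S' S'n _] :
    exists2 S', chain_to S' (b + c) & {subset S' <= preim_pred f T}.
  by exists S'.
elim: c T Tc Tim => [|c IH] T Tc Tim.
  rewrite addn0; exists (image_pred i S); last first.
    by move=> v /asboolP[u _ <-]; rewrite inE fi0; case: (chain_to_submod Tc).
  elim: b S Sb => [|b IHb] S Sb.
    by apply: chain_to0; apply: image_submod; apply: chain_to_submod Sb.
  have [S' [S'b S'S SS']] := chain_to_ind Sb.
  apply: chain_to_extend (IHb _ S'b) (image_submod _ (chain_to_submod Sb)) _ _.
    by move=> v /asboolP[u /S'S uS <-]; apply/asboolP; exists u.
  move=> sub; apply: SS' => u uS.
  have /asboolP[u' u'S' /i_inj <-] : i u \in image_pred i S'.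
    by apply: sub; apply/asboolP; exists u.
  exact: u'S'.
have [T' [T'c T'T TT']] := chain_to_ind Tc.
have [|S' S'n S'T'] := IH T' T'c; first by move=> w /T'T /Tim.
rewrite addnS; exists (preim_pred f T) => //.
apply: chain_to_extend S'n (preim_submod _ (chain_to_submod Tc)) _ _.
  by move=> v /S'T'; rewrite !inE; apply: T'T.
move=> sub; apply: TT' => w wT; have /asboolP[v _ fv] := Tim _ wT.
by rewrite -fv; apply: S'T'; apply: sub; rewrite inE fv.
Qed.

End LengthExact.

(** * The characters of objects *)

Section Finite.
Variables (k : comPzRingType) (C : lincat k).
Hypotheses (Cab : abelian C) (Cfin : hom_finite C).

(** The End(M)-submodules of Hom(X, M) are k-submodules. *)
Lemma EndHom_length (M X : C) : has_length (EndHom M X) (char_of M X).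
Proof.
have [n [_ Xn]] := Cfin X M.
apply: (@has_length_bounded _ _ n) => U m [Usub Ustrict]; apply: Xn (U) _ _.
split=> // i /Usub [U0 Ul]; split=> // a u v uU vU.
have -> : a *: u + v
    = ((a *: idm M : End M) *: (u : EndHom M X) + v : EndHom M X).
  by congr (_ + _); rewrite -[LHS](congr1 ( *:%R a) (comp_idl u)) -compZl.
exact: Ul.
Qed.

Section Fixed.
Variable M : C.

Definition precomp (X W : C) (a : hom X W) (g : EndHom M W) : EndHom M X :=
  (g : hom W M) \oc a.

Fact precomp_linear (X W : C) (a : hom X W) : linear (precomp a).
Proof.
move=> x g h; rewrite /precomp compDl; congr (_ + _).
by rewrite [LHS](esym (comp_assoc _ _ _)).
Qed.

HB.instance Definition _ (X W : C) (a : hom X W) :=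
  GRing.isLinear.Build (End M) (EndHom M W) (EndHom M X) *:%R (precomp a)
    (precomp_linear a).

Definition factors (X W : C) (a : hom X W) (v : hom X M) : Prop :=
  exists t : hom W M, t \oc a = v.

Let restr (X W : C) (a : hom X W) : {pred EndHom M X} :=
  image_pred (precomp a : {linear _ -> _}) predT.

Lemma restrP (X W : C) (a : hom X W) (v : EndHom M X) :
  reflect (factors a v) (v \in restr a).
Proof.
apply: (iffP (asboolP _)) => [[t _ ta]|[t ta]]; first by exists t.
by exists t.
Qed.

Lemma restr_submod (X W : C) (a : hom X W) : submod_closed (restr a).
Proof. by apply: image_submod; split. Qed.

Lemma char_of_join (X W Q : C) (a : hom X W) (q : hom W Q) c :
  is_cokernel a q -> chain_in (restr a) c ->
  (char_of M Q + c <= char_of M W)%N.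
Proof.
move=> aq ac; have /has_lengthP [_ bound] := EndHom_length M W; apply: bound.
have /has_lengthP [Qn _] := EndHom_length M Q.
apply: (chain_join (i := precomp q : {linear _ -> _}) _ _ Qn ac).
  by move=> g h; apply: (coker_epi aq).
by move=> g; rewrite /= /precomp -comp_assoc aq.1 comp0r.
Qed.

Lemma char_of_split (X W Q : C) (a : hom X W) (q : hom W Q) :
  is_cokernel a q ->
  exists2 c, (char_of M W <= char_of M Q + c)%N & chain_in (restr a) c.
Proof.
move=> aq; have /has_lengthP [Wn _] := EndHom_length M W.
apply: (chain_split (i := precomp q : {linear _ -> _}) _ _ Wn).
  by move=> g /(coker_factor aq).
exact: EndHom_length.
Qed.

Lemma char_of_character : character (char_of M).
Proof.
split=> [X Y S|X Y Z f g fg]; last first.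
  have [c Y_le fc] := char_of_split fg.
  have /has_lengthP [_ bound] := EndHom_length M X.
  suff : (c <= char_of M X)%N by lia.
  by apply: bound; apply: chain_in_sub fc.
move=> [iX [iY [pX [pY [eX eY eXY eYX eS]]]]].
have c := direct_sum_coker eY eYX eS.
apply/eqP; rewrite eqn_leq addnC; apply/andP; split.
  have [n S_le Xn] := char_of_split c.
  have /has_lengthP [_ bound] := EndHom_length M X.
  suff : (n <= char_of M X)%N by lia.
  by apply: bound; apply: chain_in_sub Xn.
apply: (char_of_join c); have /has_lengthP [Xn _] := EndHom_length M X.
apply: chain_in_sub Xn => v _; apply/restrP; exists (v \oc pX).
by rewrite -comp_assoc eX comp_idr.
Qed.

Local Notation rM := (rank Cab (char_of M)).

Lemma rank_factors_le (X W W' : C) (a : hom X W) (b : hom X W') :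
  (forall v, factors a v -> factors b v) -> (rM a <= rM b)%N.
Proof.
move=> ab; have [Q [q aq]] := ab_coker Cab a; have [R [r br]] := ab_coker Cab b.
have [c W_le ac] := char_of_split aq.
have ab' : {subset restr a <= restr b} by move=> v /restrP /ab vb; apply/restrP.
by have := char_of_join br (chain_in_sub ab' ac);
   have := rank_coker Cab char_of_character aq;
   have := rank_coker Cab char_of_character br; lia.
Qed.

(** At chi_M the rank of a is the length of its image in Hom(X, M), so equal
    ranks force equal images. *)
Lemma factors_rank (X W W' : C) (a : hom X W) (g : hom W W') (v : hom X M) :
  (rM a <= rM (g \oc a))%N -> factors a v -> factors (g \oc a) v.
Proof.
move=> rank_le [t ta]; apply: contrapT => nv.
have [Q [q aq]] := ab_coker Cab a.
have [R [r gar]] := ab_coker Cab (g \oc a).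
have [c W_le gac] := char_of_split gar.
have ac : chain_in (restr a) c.+1.
  apply: chain_in_lt gac (restr_submod a) _ _ => [w /restrP [s sga]|sub].
    by apply/restrP; exists (s \oc g); rewrite -comp_assoc.
  by apply: nv; apply/restrP; apply: sub; apply/restrP; exists t.
have := char_of_join aq ac.
by have := rank_coker Cab char_of_character aq;
   have := rank_coker Cab char_of_character gar; lia.
Qed.

End Fixed.

End Finite.

(** * Indecomposable objects *)

Section Indecomposable.
Variables (k : comPzRingType) (C : lincat k).

Definition indecomposable (M : C) : Prop :=
  ~ zero_object M /\
  forall e : hom M M, e \oc e = e -> e = 0 \/ e = idm M.

Lemma iso_of_inverses (X Y : C) (f : hom X Y) (g h : hom Y X) :
  g \oc f = idm X -> f \oc h = idm Y -> iso f.
Proof.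
move=> gf fh; exists g; split=> //.
by rewrite -(comp_idr g) -fh (comp_assoc g) gf comp_idl.
Qed.

Lemma indecomposable_split (M : C) (a c : hom M M) :
  indecomposable M -> c \oc a = idm M -> iso a.
Proof.
move=> [M0 Mind] ca; apply: (iso_of_inverses ca (h := c)).
have [||//] := Mind (a \oc c).
  by rewrite comp_assoc -(comp_assoc a) ca comp_idr.
move=> ac; case: M0; apply: zero_object_idm.
have -> : idm M = c \oc (a \oc c) \oc a by rewrite comp_assoc ca comp_idl ca.
by rewrite ac comp0r comp0l.
Qed.

(** Fitting's lemma: if both left and right multiplication by a large power x
    of a have stationary image, then x = b x^2 = x^2 c, and b x = x c is an
    idempotent; it is 0 if a is nilpotent and 1 if a is invertible. *)
Lemma fitting (M : C) (a : hom M M) :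
  hom_finite C -> indecomposable M -> iso a \/ iso (idm M - a).
Proof.
move=> Cfin [_ Mind]; have [l Vl] := Cfin M M.
pose pre : {linear hom M M -> hom M M} :=
  HB.pack (fun g : hom M M => g \oc a)
    (GRing.isLinear.Build k (hom M M) (hom M M) *:%R _ (comp_linearl a)).
pose post : {linear hom M M -> hom M M} :=
  HB.pack (fun g : hom M M => a \oc g)
    (GRing.isLinear.Build k (hom M M) (hom M M) *:%R _ (comp_linearr a)).
have [n1 stable1] := iter_image_stable pre Vl.
have [n2 stable2] := iter_image_stable post Vl.
pose A : End M := a; pose n := (n1 + n2)%N; pose x := A ^+ n.+1.
have preE i (g : End M) : iter i pre g = g * A ^+ i.
  elim: i => [|i IH]; first by rewrite mulr1.
  by rewrite iterS IH exprSr mulrA.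
have postE i (g : End M) : iter i post g = A ^+ i * g.
  elim: i => [|i IH]; first by rewrite mul1r.
  by rewrite iterS IH exprS -mulrA.
have [b xb] : exists b : End M, x = b * (x * x).
  have [|b] := stable1 n.+1 _ (1 : End M); first by rewrite /n; lia.
  by rewrite !preE exprD mul1r => xb; exists b.
have [c xc] : exists c : End M, x = x * x * c.
  have [|c] := stable2 n.+1 _ (1 : End M); first by rewrite /n; lia.
  by rewrite !postE exprD mulr1 => xc; exists c.
have bxc : b * x = x * c by rewrite {1}xc -mulrA !mulrA -(mulrA b) -xb.
have ee : (b * x) * (b * x) = b * x.
  by rewrite {2}bxc mulrA -(mulrA b) -xb -bxc.
have [e0|e1] := Mind (b * x) ee.
- right; have x0 : x = 0 by rewrite xb mulrA (e0 : b * x = 0) mul0r.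
  pose s := \sum_(i < n.+1) A ^+ i.
  have s1 : (1 - A) * s = 1.
    by rewrite -opprB mulNr -subrX1 -/x x0 sub0r opprK.
  have s2 : s * (1 - A) = 1.
    rewrite -[RHS]s1; apply: commr_sym.
    by apply: commr_sum => i _; apply/commrX/commr_sym/commrB; [apply: commr1|].
  exact: iso_of_inverses s2 s1.
- left; apply: (iso_of_inverses (g := b * A ^+ n) (h := A ^+ n * c)).
    by rewrite -[RHS]e1 /x exprSr mulrA.
  by rewrite -[RHS]e1 bxc /x exprS -mulrA.
Qed.

(** For an idempotent e the images of e and 1 - e are complements in M. *)
Lemma decomposable_sum (M : C) :
  abelian C -> ~ zero_object M -> ~ indecomposable M ->
  exists A B, [/\ direct_sum A B M, proper_quotient A M & proper_quotient B M].
Proof.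
move=> Cab M0 Mdec.
have [e [ee e0 e1]] : exists e : hom M M, [/\ e \oc e = e, e <> 0 & e <> idm M].
  apply: contrapT => no; apply: Mdec; split=> // e ee; apply: contrapT => ne.
  by apply: no; exists e; split=> // e'; apply: ne; [left|right].
have split_idem (f : hom M M) : f \oc f = f ->
    exists A (q : hom M A) (m : hom A M),
    [/\ epi q, mono m, m \oc q = f & q \oc m = idm A].
  move=> ff; have [A [q [m [qe mm mq]]]] := image_ex Cab f.
  exists A, q, m; split=> //; apply: qe; apply: mm.
  by rewrite comp_idl comp_assoc comp_assoc mq -comp_assoc mq.
have ff : (idm M - e) \oc (idm M - e) = idm M - e.
  by rewrite compBl !compBr !comp_idl comp_idr ee subrr subr0.
have [A [q [m [qe mm mq qm]]]] := split_idem e ee.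
have [B [r [n [re nm nr rn]]]] := split_idem _ ff.
have qn : q \oc n = 0.
  apply: (epi_eq0 re); apply: (mono_eq0 mm).
  by rewrite -comp_assoc nr comp_assoc mq compBr comp_idr ee subrr.
have rm : r \oc m = 0.
  apply: (epi_eq0 qe); apply: (mono_eq0 nm).
  by rewrite -comp_assoc mq comp_assoc nr compBl comp_idl ee subrr.
exists A, B; split.
- by exists m, n, q, r; split=> //; rewrite mq nr addrC subrK.
- exists q; split=> // qm'; apply: e1; apply/esym/eqP; rewrite -subr_eq0 -nr.
  by apply/eqP; apply: (mono_eq0 qm'); rewrite comp_assoc qn comp0l.
- exists r; split=> // rm'; apply: e0; rewrite -mq.
  by apply: (mono_eq0 rm'); rewrite comp_assoc rm comp0l.
Qed.

End Indecomposable.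

(** * Characters of indecomposable objects are irreducible *)

Section IndecomposableChar.
Variables (k : comPzRingType) (C : lincat k).
Hypotheses (Cab : abelian C) (Cfin : hom_finite C).
Variable M : C.
Hypothesis Mind : indecomposable M.

Local Notation chiM := (char_of M).
Local Notation rM := (rank Cab chiM).
Let chiMC : character chiM := char_of_character Cfin M.

(** Among the subfunctors of Hom(M, -) generated by one morphism and without
    the identity of M, take j to generate one of maximal rank. As End(M) is
    local, its value at M is the radical. *)
Lemma radical_ex : exists W (j : hom M W),
  (forall a : hom M M, ~ iso a <-> factors j a) /\ (chiM M <= (rM j).+1)%N.
Proof.
pose P n := `[< exists W (j : hom M W), ~ factors j (idm M) /\ rM j = n >].
have exP : exists n, P n.
  exists 0%N; apply/asboolP; exists M, 0; split; last exact: rank0.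
  move=> [t]; rewrite comp0r => /esym id0.
  by case: Mind => M0 _; case: M0; apply: zero_object_idm.
have ubP n : P n -> (n <= chiM M)%N.
  move=> /asboolP[W [j [_ <-]]]; rewrite -(rank_idm Cab chiMC) -(comp_idr j).
  exact: rank_comp_le.
case: (ex_maxnP exP ubP) => n /asboolP[W [j [nj rj]]] n_max.
have radP (a : hom M M) : ~ iso a <-> factors j a.
  split=> [na|[t tj] ai]; last first.
    case: ai => g [ga _]; apply: nj; exists (g \oc t).
    by rewrite -comp_assoc tj.
  have [S [iW [iM [pW [pM [eW eM eWM eMW eS]]]]]] := ab_sum Cab W M.
  pose h := iW \oc j + iM \oc a.
  have hW : pW \oc h = j.
    by rewrite compDr !comp_assoc eW eWM comp0l comp_idl addr0.
  have hM : pM \oc h = a.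
    by rewrite compDr !comp_assoc eM eMW comp0l comp_idl add0r.
  rewrite -hW; apply: factors_rank => //; last by exists pM.
  rewrite hW rj; apply: n_max; apply/asboolP; exists S, h; split=> // -[t th].
  have e : idm M - t \oc iW \oc j = t \oc iM \oc a.
    by rewrite -th compDr !comp_assoc addrC addKr.
  have [[g [gx _]]|[g [gx _]]] := fitting (t \oc iW \oc j) Cfin Mind.
    by apply: nj; exists (g \oc (t \oc iW)); rewrite -comp_assoc.
  apply: na; apply: (indecomposable_split (c := g \oc (t \oc iM))) => //.
  by rewrite -comp_assoc -e.
exists W, j; split=> //.
(* A proper left ideal contains no invertible element, hence lies in the
   radical, so any chain of left ideals stays there up to its last step. *)
have /has_lengthP [] := EndHom_length Cfin M M.
case: (chiM M) => // m [T Tm _] _; have [S [Sm ST TS]] := chain_to_ind Tm.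
have Ssub := chain_to_submod Sm.
have [Q [q jq]] := ab_coker Cab j; have := rank_coker Cab chiMC jq.
suff : (char_of M Q + m <= chiM W)%N by lia.
apply: (char_of_join Cfin jq); exists S => // a aS; apply/restrP/radP => ai.
apply: TS => v _; case: ai => g [ga _]; case: Ssub => S0 Sl.
have -> : v = ((v : hom M M) \oc g : End M) *: a + 0.
  by rewrite addr0; rewrite [RHS](esym (comp_assoc _ _ _)) ga comp_idr.
exact: Sl.
Qed.

(** The value of a summand phi of chi_M at the simple functor
    Hom(M, -) / (j) decides whether phi vanishes: evaluated at M, every
    Hom(X, -) is filtered by copies of that simple functor. *)
Lemma summand_vanish (W0 : C) (j : hom M W0) (phi psi : C -> nat) :
  (forall a : hom M M, ~ iso a <-> factors j a) ->
  character phi -> character psi -> (forall X, chiM X = phi X + psi X)%N ->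
  (phi M <= rank Cab phi j)%N -> forall X, phi X = 0%N.
Proof.
move=> radP phiC psiC e phi_j X.
have rankD Y Z (f : hom Y Z) : rM f = (rank Cab phi f + rank Cab psi f)%N.
  have [Q [q fq]] := ab_coker Cab f; have := rank_coker Cab chiMC fq.
  by rewrite !e -(rank_coker Cab phiC fq) -(rank_coker Cab psiC fq); lia.
have rank_phi Y Z Z' (f : hom Y Z) (g : hom Z Z') : (rM f <= rM (g \oc f))%N ->
    rank Cab phi (g \oc f) = rank Cab phi f.
  rewrite !rankD.
  by have := rank_comp_le Cab phiC f g; have := rank_comp_le Cab psiC f g; lia.
pose P n := `[< exists W (a : hom X W), rank Cab phi a = 0%N /\ rM a = n >].
have exP : exists n, P n.
  by exists 0%N; apply/asboolP; exists X, 0; rewrite !rank0.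
have ubP n : P n -> (n <= chiM X)%N.
  move=> /asboolP[W [a [_ <-]]]; rewrite -(rank_idm Cab chiMC) -(comp_idr a).
  exact: rank_comp_le.
case: (ex_maxnP exP ubP) => n /asboolP[W [a [phi_a ra]]] n_max.
have [all_a|] := pselect (forall v : hom X M, factors a v).
  rewrite -(rank_idm Cab phiC) -phi_a -[in RHS](comp_idr a).
  by apply/esym/rank_phi; rewrite comp_idr; apply: rank_factors_le.
move=> /existsNP [v0 nv0].
have [S [iW [iM [pW [pM eS]]]]] := ab_sum Cab W M.
have [eW eM eWM eMW _] := eS.
pose pair (v : hom X M) := iW \oc a + iM \oc v.
have pairW v : pW \oc pair v = a.
  by rewrite compDr !comp_assoc eW eWM comp0l comp_idl addr0.
have pairM v : pM \oc pair v = v.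
  by rewrite compDr !comp_assoc eM eMW comp0l comp_idl add0r.
(* Choose v outside the subfunctor generated by a, with the module generated by
   both as small as possible: its quotient by the former is then simple. *)
pose Q n := `[< exists v : hom X M, ~ factors a v /\ rM (pair v) = n >].
have exQ : exists n, Q n by exists (rM (pair v0)); apply/asboolP; exists v0.
case: (ex_minnP exQ) => m /asboolP[v [nv rv]] m_min.
have rad_v (b : hom M M) : ~ iso b -> factors a (b \oc v).
  move=> nb; apply: contrapT => nbv.
  have pairE : (iW \oc pW + iM \oc b \oc pM) \oc pair v = pair (b \oc v).
    by rewrite compDl -!comp_assoc pairW pairM.
  have [|t tv] := @factors_rank _ _ Cab Cfin M _ _ _ (pair v)
      (iW \oc pW + iM \oc b \oc pM) v _ (ex_intro _ pM (pairM v)).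
    by rewrite pairE rv; apply: m_min; apply/asboolP; exists (b \oc v).
  rewrite pairE in tv.
  have e' : (idm M - t \oc iM \oc b) \oc v = t \oc iW \oc a.
    by rewrite compBl comp_idl -{1}tv compDr !comp_assoc addrK.
  have [[g [gx _]]|[g [gx _]]] := fitting (t \oc iM \oc b) Cfin Mind.
    apply: nb; apply: (indecomposable_split (c := g \oc (t \oc iM))) => //.
    by rewrite -comp_assoc.
  apply: nv; exists (g \oc (t \oc iW)).
  by rewrite -comp_assoc -e' comp_assoc gx comp_idl.
have [R [u [w po]]] := pushout_ex Cab a v.
have phi_w : (phi M <= rank Cab phi w)%N.
  apply: leq_trans phi_j _.
  have [T [iR [i0 [pR [p0 [eR e0 eR0 e0R _]]]]]] := ab_sum Cab R W0.
  pose h := iR \oc w + i0 \oc j.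
  have hR : pR \oc h = w.
    by rewrite compDr !comp_assoc eR eR0 comp0l comp_idl addr0.
  have h0 : p0 \oc h = j.
    by rewrite compDr !comp_assoc e0 e0R comp0l comp_idl add0r.
  apply: (@leq_trans (rank Cab phi h)); first by rewrite -h0 rank_comp_le.
  rewrite -hR rank_phi // hR; apply: rank_factors_le => // b [t tb].
  have [s sa] : factors a ((t \oc i0 \oc j) \oc v).
    by apply/rad_v/radP; exists (t \oc i0).
  have [_ ex _] := po; have [s' _ s'w] := ex _ _ _ sa.
  exists (t \oc iR + s'); rewrite -tb compDl s'w compDr !comp_assoc.
  by [].
have [D [q aq]] := ab_coker Cab a; have [t [_ _ wt]] := pushout_coker po aq.
have phi_pair : rank Cab phi (pair v) = 0%N.
  have := rank_pair Cab phiC eS po; have := rank_coker Cab phiC aq.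
  by have := rank_coker Cab phiC wt; rewrite -/(pair v); lia.
case: nv; rewrite -(pairW v); apply: factors_rank => //; last by exists pM.
by rewrite pairW ra; apply: n_max; apply/asboolP; exists S, (pair v).
Qed.

Lemma char_of_irreducible : irreducible chiM.
Proof.
have [W [j [radP j_max]]] := radical_ex.
split=> //.
  move=> chi0; case: Mind => M0 _; apply: M0; apply: zero_object_idm.
  have rM0 X Y (f : hom X Y) : rM f = 0%N.
    have [Q [q fq]] := ab_coker Cab f; have := rank_coker Cab chiMC fq.
    by rewrite {2 3}chi0 /zero_char; lia.
  have [||t <-] := @factors_rank _ _ Cab Cfin M M M M (idm M) 0 (idm M).
  - by rewrite !rM0.
  - by exists (idm M); rewrite comp_idl.
  - by rewrite comp0l comp0r.
move=> [phi [psi [phiC psiC phi0 psi0 e]]].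
have eX X : chiM X = (phi X + psi X)%N by rewrite e.
have eX' X : chiM X = (psi X + phi X)%N by rewrite eX addnC.
have [Q [q jq]] := ab_coker Cab j.
have [phi_j|phi_j] := leqP (phi M) (rank Cab phi j).
  apply: phi0; apply: funext.
  exact: (summand_vanish radP phiC psiC eX phi_j).
apply: psi0; apply: funext; apply: (summand_vanish radP psiC phiC eX').
have := rank_coker Cab chiMC jq; have := rank_coker Cab phiC jq.
have := rank_coker Cab psiC jq; have := eX M; have := eX W; have := eX Q; lia.
Qed.

End IndecomposableChar.

(** * Finite characters detect subobject-closed subcategories *)

Section FiniteCharacters.
Variables (k : comPzRingType) (C : lincat k).
Hypotheses (Cab : abelian C) (Cfin : hom_finite C).
Variables (D : set C) (M : C).
Hypothesis Dsoc : subobject_closed D.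

Lemma rank_epi (chi : C -> nat) (X Y : C) (q : hom X Y) :
  character chi -> epi q -> rank Cab chi q = chi Y.
Proof.
move=> chiC qe; have [O O0] := ab_zero Cab.
have := rank_coker Cab chiC (zero_coker 0 O0 qe).
by rewrite (char_zero chiC O0) addn0.
Qed.

Lemma char_of_reflection (p : C -> full_subcat D) (X : C) :
  left_adjoint p -> D M -> char_of M X = char_of M (sval (p X)).
Proof.
move=> p_adj DM; have chiC := char_of_character Cfin M.
have univ := @unit_universal _ _ _ p p_adj X.
have re := universal_epi Cab Dsoc univ.
apply/eqP; rewrite eqn_leq (char_epi chiC (ab_zero Cab) re) andbT.
rewrite -(rank_epi chiC re) -(rank_idm Cab chiC).
by apply: rank_factors_le => // v _; apply: (universal_factor univ v DM).
Qed.

(** If M is reflected in D without loss of length, the identity of M factors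
    through its reflection, which is therefore a monomorphism. *)
Lemma Sp_of_char_of (phi : Sp C) : sval phi = char_of M ->
  (exists p : C -> full_subcat D, left_adjoint p) -> Sp_of D phi <-> D M.
Proof.
move=> phiM [p p_adj]; split=> [/(Sp_of_reflection Dsoc)|DM]; last first.
  apply: (Sp_of_intro Cab Dsoc p_adj) => X.
  by rewrite phiM; apply: char_of_reflection.
rewrite phiM => -[p' p'_adj e]; have chiC := char_of_character Cfin M.
have re := universal_epi Cab Dsoc (@unit_universal _ _ _ p' p'_adj M).
have [||t] := @factors_rank _ _ Cab Cfin M _ _ _ (idm M) (unit_arrow p'_adj M)
    (idm M).
- by rewrite comp_idr rank_idm // rank_epi // e.
- by exists (idm M); rewrite comp_idl.
rewrite comp_idr => tr.
apply: (soc_sub Dsoc (f := unit_arrow p'_adj M)) (svalP (p' M)).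
by apply: (@mono_cancel _ _ _ _ _ t); rewrite tr; apply: idm_mono.
Qed.

End FiniteCharacters.

Section Determined.
Variables (k : comPzRingType) (C : lincat k).
Hypotheses (Cab : abelian C) (Clength : length_category C).
Hypothesis Cfin : hom_finite C.

(** An object M of D(chi) is a direct sum of indecomposable ones, again in
    D(chi). If M itself is indecomposable, chi_M lies in sub chi, hence in
    sub psi and in Sp D(psi), so M lies in D(psi). *)
Lemma finite_chars_reduced (chi psi : Sp C) :
  (forall phi, sub chi phi -> finite_char phi -> sub psi phi) ->
  reduced (sval chi) `<=` reduced (sval psi).
Proof.
move=> sub_fin M.
have [[chiC _ _] [psiC _ _]] := (svalP chi, svalP psi).
have chi_soc := reduced_closed Cab chiC.
have psi_soc := reduced_closed Cab psiC.
elim: (proper_quotient_wf Cab (Clength M)) => {}M _ IH Mred.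
have [M0|M0] := pselect (zero_object M).
  have [Z Z0 DZ] := soc_zero psi_soc.
  apply: (soc_sub psi_soc (f := 0 : hom M Z)) DZ.
  by apply: mono_ker0 => W g _; apply: M0.1.
have [Mind|Mdec] := pselect (indecomposable M); last first.
  have [A [B [AB Aq Bq]]] := decomposable_sum Cab M0 Mdec.
  have [iA [iB [pA [pB [eA eB _ _ _]]]]] := AB.
  apply: (soc_sum psi_soc _ _ AB); apply: IH => //.
    apply: (soc_sub chi_soc (f := iA)) Mred.
    by apply: (@mono_cancel _ _ _ _ _ pA); rewrite eA; apply: idm_mono.
  apply: (soc_sub chi_soc (f := iB)) Mred.
  by apply: (@mono_cancel _ _ _ _ _ pB); rewrite eB; apply: idm_mono.
pose phi : Sp C := exist _ _ (char_of_irreducible Cab Cfin Mind).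
have [p p_adj _] := reduced_reflection Cab psiC Clength.
apply/(Sp_of_char_of Cab Cfin psi_soc (phi := phi) erefl); first by exists p.
apply: (sub_fin phi); last 2 first.
- by exists M.
- by split; [exists (reduced (sval psi))|apply: Sp_of_reduced].
move=> _ [[D [Dsoc ->]] chiD].
have [q q_adj _] := Sp_of_reflection Dsoc chiD.
apply/(Sp_of_char_of Cab Cfin Dsoc (phi := phi) erefl); first by exists q.
exact: (reduced_sub Cab Dsoc chiD).
Qed.

Lemma Sp_determined (chi psi : Sp C) :
  [set phi | sub chi phi /\ finite_char phi]
    = [set phi | sub psi phi /\ finite_char phi] ->
  chi = psi.
Proof.
move=> e; apply: (reduced_inj Cab Clength); apply/seteqP; split.
  apply: finite_chars_reduced => phi sub_phi fin_phi.
  by have [] : [set phi | sub psi phi /\ finite_char phi] phi by rewrite -e.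
apply: finite_chars_reduced => phi sub_phi fin_phi.
by have [] : [set phi | sub chi phi /\ finite_char phi] phi by rewrite e.
Qed.

End Determined.

Theorem corollary4p4 (k : comPzRingType) (C : lincat k)
    (Cabelian : abelian C) (Clength : length_category C)
    (Cfin : hom_finite C) :
  Relation_Definitions.order (Sp C) (@sub_le k C) /\
  (forall chi psi : Sp C,
     [set phi | sub chi phi /\ finite_char phi]
       = [set phi | sub psi phi /\ finite_char phi] ->
     chi = psi).
Proof.
split; last exact: Sp_determined.
split=> [chi phi //|chi psi phi le1 le2 mu /le1 /le2 //|chi psi le1 le2].
apply: (Sp_determined Cabelian Clength Cfin); apply/seteqP.
by split=> phi [? ?]; split=> //; [apply: le1|apply: le2].
Qed.
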